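(* Let $m=2$, let $n$ be a positive integer and let $\delta,\sigma_1,\sigma_2,\dots,\sigma_n$ be distinct positive constants. Fix $\hat x\in\mathbb{S}^1$ with $\hat x\cdot d\neq0$, and let $\tau$ be a real constant with $\tau\notin\left\{\frac{\ell\pi}{k\hat x\cdot d}:\ell\in\mathbb{Z}\right\}$. Define $$w(x,d):=|x|^{1/2}e^{k|x|}\,\frac{|u(x,d)|^2-|e^{ikx\cdot d}+u_H(x,d)|^2}{|e^{ikx\cdot d}+u_H(x,d)|}.$$ For each sufficiently large $t$ and $j\in\{1,\dots,n\}$ let $t_j=\sigma_jt+b_j$, with $b_1\in(-\delta,\delta)$ and $b_j\in\left(-\delta,\frac{2\pi}{k|\hat x\cdot d|}+\delta\right)$ for $j\ge2$, be such that $\arg\{e^{ikt_j\hat x\cdot d}+u_H(t_j\hat x,d)\}=k\sigma_1t\,\hat x\cdot d$ (modulo $2\pi$), and let $\tilde t_j=\sigma_jt+\tilde b_j$, with $\tilde b_1\in(\tau-\delta,\tau+\delta)$ and $\tilde b_j\in\left(-\delta,\frac{2\pi}{k|\hat x\cdot d|}+\delta\right)$ for $j\ge2$, be such that $\arg\{e^{ik\tilde t_j\hat x\cdot d}+u_H(\tilde t_j\hat x,d)\}=k(\sigma_1t+\tau)\hat x\cdot d$ (modulo $2\pi$). Define $$\begin{pmatrix}G_{1,M}\\ \vdots\\ G_{n,M}\end{pmatrix}=V(t_1,\dots,t_n)^{-1}\begin{pmatrix}w(t_1\hat x,d)\\ \vdots\\ w(t_n\hat x,d)\end{pmatrix},\qquad\begin{pmatrix}\widetilde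 G_{1,M}\\ \vdots\\ \widetilde G_{n,M}\end{pmatrix}=V(\tilde t_1,\dots,\tilde t_n)^{-1}\begin{pmatrix}w(\tilde t_1\hat x,d)\\ \vdots\\ w(\tilde t_n\hat x,d)\end{pmatrix},$$ where $V(s_1,\dots,s_n)$ is the $n\times n$ matrix whose $(i,j)$ entry is $s_i^{-(j-1)}$. Then, for $j=1,2,\dots,n$, $$\begin{pmatrix}g_j(\hat x)\\ \overline{g_j(\hat x)}\end{pmatrix}=\begin{pmatrix}e^{-ik\sigma_1t\hat x\cdot d}&e^{ik\sigma_1t\hat x\cdot d}\\ e^{-ik(\sigma_1t+\tau)\hat x\cdot d}&e^{ik(\sigma_1t+\tau)\hat x\cdot d}\end{pmatrix}^{-1}\begin{pmatrix}G_{j,M}\\ \widetilde G_{j,M}\end{pmatrix}+O\left(\frac1{t^{n+1-j}}\right)\quad\text{as }t\to\infty.$$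
   Context: Let $m=2$, $k>0$, and let $D\subset\mathbb{R}^2$ be a bounded domain with boundary $\partial D$ of class $C^{3,\alpha}$ which is the open complement of an unbounded domain. $\nu$ is the unit exterior normal on $\partial D$. Fix $d\in\mathbb{S}^1$. The incident field is $u^i(x,d)=e^{ikx\cdot d}$; the total field $u=u^i+u^s$ satisfies $\Delta^2u-k^4u=0$ in $\mathbb{R}^2\setminus\overline D$, $\mathscr{B}u=(0,0)$ on $\partial D$ with $\mathscr{B}u$ one of $(u,\partial_\nu u)$, $(u,\Delta u)$, $(\Delta u,\partial_\nu\Delta u)$, $(u,\partial_\nu\Delta u)$, $(\partial_\nu u,\Delta u)$, $(\partial_\nu u,\partial_\nu\Delta u)$, and $\lim_{r\to\infty}r^{1/2}\left(\partial_ru^s-iku^s\right)=0$, $r=|x|$, uniformly in all directions. Set $u_H:=\frac12(u^s-\Delta u^s/k^2)$ and $u_M:=\frac12(u^s+\Delta u^s/k^2)$, so $u^s=u_H+u_M$, $\Delta u_H+k^2u_H=0$, $\Delta u_M-k^2u_M=0$ in $\mathbb{R}^2\setminus\overline D$, and both satisfy the same radiation condition. The functions $g_j$ on $\mathbb{S}^1$ are the coefficients of the Atkinson-type expansion of $u_M=u_M(\cdot,d)$: for every $N\in\mathbb{N}$, $$u_M(x)=\frac{e^{-k|x|}}{|x|^{1/2}}\left\{\sum_{j=1}^N\frac{g_j(\hat x)}{|x|^{j-1}}+O\left(\frac1{|x|^N}\right)\right\},\quad|x|\to\infty,\ \hat x=x/|x|;$$ in particular $g_1=u_M^\infty$ is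 the far-field pattern of $u_M$. Arguments of complex numbers are understood modulo $2\pi$. Parameters $b_j,\tilde b_j$ with the stated properties exist for all sufficiently large $t$ (they depend on $t$). *)

(* Defs.v *)
From HB Require Import structures.
From mathcomp Require Import all_boot all_order all_algebra.
From mathcomp Require Import complex.
From mathcomp Require Import all_classical all_reals all_analysis.

Set Implicit Arguments.
Unset Strict Implicit.
Unset Printing Implicit Defensive.

Import Order.TTheory GRing.Theory Num.Theory.
Import numFieldNormedType.Exports.
Import ComplexField.Normc.

Local Open Scope classical_set_scope.
Local Open Scope ring_scope.
Local Open Scope complex_scope.

Section Plane.
Context {R : realType}.
Local Notation plane := 'rV[R]_2.

(* The library norm on ['rV[R]_2] is the sup norm (it induces the right topology
   and the right bounded sets); [enorm] is the Euclidean length |x|. *)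
Definition dot (x y : plane) : R := \sum_(i < 2) x ord0 i * y ord0 i.
Definition enorm (x : plane) : R := Num.sqrt (dot x x).

Definition cis (theta : R) : R[i] := cos theta +i* sin theta.

(* arg z = theta modulo 2 pi; undefined, hence false, at z = 0. *)
Definition is_arg (z : R[i]) (theta : R) : Prop :=
  z != 0 /\ z = (normc z)%:C * cis theta.

Definition derc (v : plane) (f : plane -> R[i]) (x : plane) : R[i] :=
  derive (fun y => complex.Re (f y)) x v +i* derive (fun y => complex.Im (f y)) x v.

Definition laplacian (f : plane -> R[i]) (x : plane) : R[i] :=
  \sum_(i < 2) derc (delta_mx ord0 i) (derc (delta_mx ord0 i) f) x.

(* Meant for open U. *)
Fixpoint class_C (m : nat) (U : set plane) (f : plane -> R) : Prop :=
  match m with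
  | 0 => forall x, U x -> {for x, continuous f}
  | m'.+1 => (forall x, U x -> differentiable f x) /\
             forall v, class_C m' U (fun x => derive f x v)
  end.

Definition class_Cc (m : nat) (U : set plane) (f : plane -> R[i]) : Prop :=
  class_C m U (fun x => complex.Re (f x)) /\ class_C m U (fun x => complex.Im (f x)).

Definition boundary (D : set plane) : set plane := closure D `\` interior D.
Definition exterior (D : set plane) : set plane := ~` closure D.

Definition class_C3_holder (alpha : R) (phi : R -> R) : Prop :=
  (forall m x, (m < 3)%N -> derivable (derive1n m phi) x 1) /\
  exists L : R, forall x y, `|derive1n 3 phi x - derive1n 3 phi y| <= L * `|x - y| `^ alpha.

(* In the orthonormal frame (e, n) centred at p, the set D is, near p, the
   strict subgraph {s_n < phi(s_e)}. *)
Definition local_subgraph (D : set plane) (p e n : plane) (phi : R -> R) : Prop :=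
  [/\ dot e e = 1, dot n n = 1, dot e n = 0 &
      \forall y \near p, D y <-> dot (y - p) n < phi (dot (y - p) e)].

Definition C3_holder_boundary (alpha : R) (D : set plane) : Prop :=
  forall p, boundary D p -> exists (e n : plane) (phi : R -> R),
    class_C3_holder alpha phi /\ local_subgraph D p e n phi.

(* The gradient of s_n - phi(s_e) at p, normalized. *)
Definition exterior_normal (D : set plane) (p v : plane) : Prop :=
  exists (e n : plane) (phi : R -> R), [/\ derivable phi 0 1, local_subgraph D p e n phi &
    v = (Num.sqrt (1 + derive1 phi 0 ^+ 2))^-1 *: (n - derive1 phi 0 *: e)].

(* Bounded domain which is the open complement of an unbounded domain,
   namely of its exterior. *)
Definition obstacle (alpha : R) (D : set plane) : Prop :=
  [/\ open D, connected D, D !=set0 & bounded_set D] /\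
  [/\ connected (exterior D), ~ bounded_set (exterior D) &
      C3_holder_boundary alpha D].

(* The boundary value is the limit from the exterior. *)
Definition zero_trace (D : set plane) (f : plane -> R[i]) (p : plane) : Prop :=
  normc (f y) @[y --> within (exterior D) (nbhs p)] --> (0 : R).

Inductive boundary_operator :=
| B_u_dnu | B_u_lap | B_lap_dnlap | B_u_dnlap | B_dnu_lap | B_dnu_dnlap.

Definition boundary_condition (B : boundary_operator) (D : set plane)
    (nu : plane -> plane) (u : plane -> R[i]) : Prop :=
  forall p, boundary D p ->
  let u0 := zero_trace D u p in
  let dnu0 := zero_trace D (derc (nu p) u) p in
  let lap0 := zero_trace D (laplacian u) p in
  let dnlap0 := zero_trace D (derc (nu p) (laplacian u)) p in
  match B with
  | B_u_dnu => u0 /\ dnu0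
  | B_u_lap => u0 /\ lap0
  | B_lap_dnlap => lap0 /\ dnlap0
  | B_u_dnlap => u0 /\ dnlap0
  | B_dnu_lap => dnu0 /\ lap0
  | B_dnu_dnlap => dnu0 /\ dnlap0
  end.

Definition incident (k : R) (d x : plane) : R[i] := cis (k * dot x d).

Definition scattered (k : R) (d : plane) (u : plane -> R[i]) (x : plane) : R[i] :=
  u x - incident k d x.

(* r^(1/2) (d_r v - i k v) -> 0 as r -> oo, uniformly in the direction y. *)
Definition radiating (k : R) (v : plane -> R[i]) : Prop :=
  forall eps : R, 0 < eps -> \forall r \near +oo, forall y, enorm y = 1 ->
  Num.sqrt r *
    normc (derc y v (r *: y) - (0 +i* k) * v (r *: y)) < eps.

Definition scattering_solution (B : boundary_operator) (k : R) (D : set plane)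
    (nu : plane -> plane) (d : plane) (u : plane -> R[i]) : Prop :=
  [/\ class_Cc 4 (exterior D) u,
      forall x, exterior D x -> laplacian (laplacian u) x - (k ^+ 4)%:C * u x = 0,
      boundary_condition B D nu u &
      radiating k (scattered k d u)].

Definition u_H (k : R) (d : plane) (u : plane -> R[i]) (x : plane) : R[i] :=
  2^-1 * (scattered k d u x - laplacian (scattered k d u) x / (k ^+ 2)%:C).

Definition u_M (k : R) (d : plane) (u : plane -> R[i]) (x : plane) : R[i] :=
  2^-1 * (scattered k d u x + laplacian (scattered k d u) x / (k ^+ 2)%:C).

(* The coefficients are indexed from 1: [g 1] is the far-field pattern and the
   value [g 0] is irrelevant. Only the values on the unit circle matter, and the
   O-term is uniform in the direction y. *)
Definition atkinson_expansion (k : R) (v : plane -> R[i])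
    (g : nat -> plane -> R[i]) : Prop :=
  forall N : nat, exists C : R, \forall r \near +oo, forall y, enorm y = 1 ->
  normc (v (r *: y) - (expR (- (k * r)) / Num.sqrt r)%:C *
           \sum_(1 <= j < N.+1) g j y / (r ^+ j.-1)%:C)
  <= expR (- (k * r)) / Num.sqrt r * (C / r ^+ N).

Definition incident_plus_uH (k : R) (d : plane) (u : plane -> R[i]) (x : plane) :=
  incident k d x + u_H k d u x.

Definition w (k : R) (d : plane) (u : plane -> R[i]) (x : plane) : R :=
  Num.sqrt (enorm x) * expR (k * enorm x) *
  ((normc (u x) ^+ 2 - normc (incident_plus_uH k d u x) ^+ 2) /
   normc (incident_plus_uH k d u x)).

Definition Vmx (n : nat) (s : 'I_n -> R) : 'M[R]_n :=
  \matrix_(i, j) (s i ^+ j)^-1.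

Definition sample (n : nat) (sigma : 'I_n -> R) (b : 'I_n -> R -> R) (t : R)
    (j : 'I_n) : R :=
  sigma j * t + b j t.

(* Conditions on the sampling radii at a given t; the index 0 plays the role of
   the distinguished first radius. tau0 = 0 for the t_j, tau0 = tau for the
   tilde t_j. *)
Definition admissible_offsets (n : nat) (n_gt0 : (0 < n)%N) (k : R) (d : plane)
    (u : plane -> R[i]) (xhat : plane) (delta : R) (sigma : 'I_n -> R) (tau0 : R)
    (b : 'I_n -> R -> R) (t : R) : Prop :=
  let j1 := Ordinal n_gt0 in
  [/\ tau0 - delta < b j1 t < tau0 + delta,
      forall j, j != j1 ->
        - delta < b j t < 2 * pi / (k * `|dot xhat d|) + delta &
      forall j, is_arg (incident_plus_uH k d u (sample sigma b t j *: xhat))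
                       (k * (sigma j1 * t + tau0) * dot xhat d)].

Definition G_M (n : nat) (k : R) (d : plane) (u : plane -> R[i]) (xhat : plane)
    (s : 'I_n -> R) : 'cV[R]_n :=
  invmx (Vmx s) *m \col_i w k d u (s i *: xhat).

(* Rows (exp(-i theta0), exp(i theta0)) and (exp(-i theta1), exp(i theta1)). *)
Definition phase_mx (theta0 theta1 : R) : 'M[R[i]]_2 :=
  \matrix_(i < 2, j < 2)
    let theta := if i == ord0 then theta0 else theta1 in
    cis (if j == ord0 then - theta else theta).

Definition col2 (a b : R[i]) : 'cV[R[i]]_2 :=
  \col_(i < 2) if i == ord0 then a else b.

End Plane.

(* Main.v *)
From HB Require Import structures.
Require Import Defs.
From mathcomp Require Import all_boot all_order all_algebra.
From mathcomp Require Import complex.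
From mathcomp Require Import all_classical all_reals all_analysis.
From mathcomp Require Import ring lra.
Import Order.TTheory GRing.Theory Num.Theory.
Import numFieldNormedType.Exports.
Import ComplexField.Normc.

Set Implicit Arguments.
Unset Strict Implicit.
Unset Printing Implicit Defensive.

Local Open Scope classical_set_scope.
Local Open Scope ring_scope.
Local Open Scope complex_scope.

(** Write [A] for the sum of the incident field and [u_H], [M] for [u_M], so
    that [u = A + M]. At a sampling radius [s] the angle [theta = arg A] is
    prescribed, and
      w = sqrt s e^{ks} (2 Re (e^{-i theta} M) + |M|^2 / |A|).
    Inserting the expansion of [M], the first term is the polynomial in [1/s]
    with coefficients [2 Re (e^{-i theta} g_j)], up to O(s^{-n}); the second one
    is exponentially small as soon as [|A|] is bounded below. Two linear systems
    then remain: an [n] by [n] Vandermonde system, whose inverse amplifies an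
    error in the [j]-th unknown by at most a constant times [t^(j-1)]
    ([Vmx_stable]), and a 2 by 2 system with determinant
    [2 i sin (k tau (xhat . d))], nonzero by the choice of [tau] ([phase_solve]).

    The lower bound on [|A|] holds because the incident field has modulus 1 and
    [u_H] tends to 0 along the ray ([uH_decay]). This is where the equation and
    the radiation condition enter. The decay is proved with energies on circles,
    without Hankel functions or Fourier series. With [<f, g>] the integral of
    [f] times the conjugate of [g] over the directions, and [U] for [u_H]:
    - [r Im <U_r, U>] is constant ([wV_const]);
    - a quadratic energy [H] satisfies
      H' = - 2 || r U_r + U / 2 - i k r U ||^2 <= 0 ([wH_noninc]);
    - solving for the angular derivative,
      ||U_theta||^2 / r = H / r^2 + r || U_r - i k U ||^2 + O (1/r),
      so the left-hand side tends to 0 wherever [r || U_r - i k U ||^2] does;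
    - then [U] tends to 0 uniformly on such circles, since [r ||U||^2] stays
      bounded and a one-dimensional Sobolev inequality in the angle applies
      ([sup_bound]).
    The radiation condition concerns [u^s = u_H + u_M], and nothing is assumed on
    the derivatives of [u_M]. But the squared norm [m] of [u_M] over the
    directions tends to 0 fast and [m''] dominates [|| d_r u_M ||^2], so a second
    difference gives, in every interval of length 3, a radius at which that
    derivative is small ([good_radius]). From there smallness propagates outwards
    over a bounded distance, because [|u^s|^2] grows at most exponentially up to
    the error in the radiation condition ([wave_decay]). *)

(** * Integrals over the circle *)

Section CircleMean.
Context {R : realType}.
Local Notation mu := (@lebesgue_measure R).
Implicit Types (f g : R -> R) (F G : R -> R -> R).

(** Integral over one period of the angle. *)
Definition circ f : R := \int[mu]_(t in `[0, 2 * pi]) f t.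

Lemma twopi_gt0 : 0 < 2 * pi :> R.
Proof. by rewrite mulr_gt0// pi_gt0. Qed.

Lemma circ_integrable f : continuous f ->
  mu.-integrable `[0, 2 * pi] (EFin \o f).
Proof.
move=> cf; apply: continuous_compact_integrable; first exact: segment_compact.
exact: continuous_subspaceT.
Qed.

Lemma circD f g : continuous f -> continuous g ->
  circ (fun t => f t + g t) = circ f + circ g.
Proof. by move=> cf cg; rewrite /circ RintegralD//; exact: circ_integrable. Qed.

Lemma circZ c f : continuous f -> circ (fun t => c * f t) = c * circ f.
Proof. by move=> cf; rewrite /circ RintegralZl//; exact: circ_integrable. Qed.

Lemma circ_le f g : continuous f -> continuous g -> (forall t, 0 <= t <= 2 * pi -> f t <= g t) ->
  circ f <= circ g.
Proof.
move=> cf cg fg; apply: le_Rintegral => //; exact: circ_integrable.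
Qed.

Lemma circ_cst c : circ (fun=> c) = 2 * pi * c.
Proof.
rewrite /circ Rintegral_cst//= lebesgue_measure_itv/= lte_fin twopi_gt0/= subr0.
by rewrite mulrC.
Qed.

Lemma circ_ge0 f : (forall t, 0 <= f t) -> 0 <= circ f.
Proof. by move=> f0; apply: Rintegral_ge0. Qed.

Lemma is_derive_continuous f f' : (forall t : R, is_derive t 1 f (f' t)) -> continuous f.
Proof.
move=> df t; apply/differentiable_continuous/derivable1_diffP.
by have [] := df t.
Qed.

Lemma circ_FTC (g G : R -> R) : (forall t : R, is_derive t 1 G (g t)) -> continuous g ->
  circ g = G (2 * pi) - G 0.
Proof.
move=> dG cg; rewrite /circ /Rintegral.
rewrite (@continuous_FTC2 _ g G)//.
- exact: twopi_gt0.
- exact: continuous_subspaceT.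
- have cG := is_derive_continuous dG.
  split.
  + by move=> t _; have [] := dG t.
  + by apply: cvg_at_right_filter; exact: cG.
  + by apply: cvg_at_left_filter; exact: cG.
- by move=> t _; rewrite derive1E; have [_ ->] := dG t.
Qed.

Lemma contD f g : continuous f -> continuous g -> continuous (fun t => f t + g t).
Proof. by move=> cf cg t; apply: continuousD; [exact: cf|exact: cg]. Qed.

Lemma contM f g : continuous f -> continuous g -> continuous (fun t => f t * g t).
Proof. by move=> cf cg t; apply: continuousM; [exact: cf|exact: cg]. Qed.

Lemma contC (c : R) : continuous (fun _ : R => c).
Proof. by move=> t; exact: cvg_cst. Qed.

Lemma contI : continuous (fun t : R => t).
Proof. by move=> t; exact: cvg_id. Qed.

(** Joint continuity of a function of (radius, angle) for radii above [R0]. *)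
Definition jcont (R0 : R) F := forall r t, R0 < r ->
  {for (r, t), continuous (fun p : R * R => F p.1 p.2)}.

Lemma jcont_sect R0 F r : jcont R0 F -> R0 < r -> continuous (F r).
Proof.
move=> jF Rr t.
apply: (@continuous_comp _ _ _ (fun t => (r, t)) (fun p : R * R => F p.1 p.2)).
  exact: (cvg_pair (cvg_cst r) (@cvg_id _ (nbhs t))).
exact: jF.
Qed.

Lemma jcontD R0 F G : jcont R0 F -> jcont R0 G -> jcont R0 (fun r t => F r t + G r t).
Proof. by move=> jF jG r t Rr; apply: continuousD; [exact: jF|exact: jG]. Qed.

Lemma jcontM R0 F G : jcont R0 F -> jcont R0 G -> jcont R0 (fun r t => F r t * G r t).
Proof. by move=> jF jG r t Rr; apply: continuousM; [exact: jF|exact: jG]. Qed.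

Lemma jcontN R0 F : jcont R0 F -> jcont R0 (fun r t => - F r t).
Proof. by move=> jF r t Rr; apply: continuousN; exact: jF. Qed.

Lemma jcont_r R0 : jcont R0 (fun r _ => r).
Proof. by move=> r t Rr; exact: cvg_fst. Qed.

Lemma jcont_t R0 f : continuous f -> jcont R0 (fun _ t => f t).
Proof.
move=> cf r t Rr; apply: (@continuous_comp _ _ _ snd f); first exact: cvg_snd.
exact: cf.
Qed.

(** Differentiation under the integral sign; the dominating constant is a bound
    for the derivative on a compact neighbourhood of the circle. *)
Lemma circ_derive R0 F F' r : R0 < r ->
  (forall r t : R, R0 < r -> is_derive r 1 (F^~ t) (F' r t)) ->
  jcont R0 F -> jcont R0 F' ->
  is_derive r 1 (fun r => circ (F r)) (circ (F' r)).
Proof.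
move=> Rr dF jF jF'.
pose a := (R0 + r) / 2.
have Ra : R0 < a by rewrite /a; lra.
have ar : a < r by rewrite /a; lra.
pose K := `[a, r + 1] `*` `[0, 2 * pi] : set (R * R).
have cK : compact K by apply: compact_setX; exact: segment_compact.
have cF' : {within K, continuous (fun p : R * R => F' p.1 p.2)}.
  apply: continuous_in_subspaceT => -[x y]; rewrite inE => -[/=].
  by rewrite in_itv/= => /andP[ax _ _]; apply: jF'; lra.
have [M [_ HM]] := compact_bounded (continuous_compact cF' cK).
have {}HM x t : a <= x <= r + 1 -> 0 <= t <= 2 * pi -> `|F' x t| <= `|M| + 1.
  move=> xr tr; apply: (HM (`|M| + 1)).
    by have := ler_norm M; lra.
  by exists (x, t) => //; split => /=; rewrite in_itv.
have p1E x y : a < x -> partial1of2 F x y = F' x y.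
  move=> ax; rewrite partial1of2E.
  have Rx : R0 < x by exact: lt_trans ax.
  by have [_ ->] := dF x y Rx.
have inI x : `]a, r + 1[%classic x -> a < x /\ x < r + 1.
  by rewrite /= in_itv/= => /andP[].
have h1 : `]a, r + 1[%classic r by rewrite /= in_itv/=; apply/andP; split; lra.
have h2 x : `]a, r + 1[%classic x -> mu.-integrable `[0, 2 * pi] (EFin \o F x).
  by move=> /inI[ax _]; apply/circ_integrable/(jcont_sect jF); lra.
have h3 x y : `]a, r + 1[%classic x -> `[0, 2 * pi]%classic y -> derivable (F ^~ y) x 1.
  by move=> /inI[ax _] _; have [] := dF x y (lt_trans Ra ax).
have h4 : mu.-integrable `[0, 2 * pi] (EFin \o (fun=> `|M| + 1)).
  by apply: circ_integrable => ?; exact: cvg_cst.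
have h5 x y : `]a, r + 1[%classic x -> `[0, 2 * pi]%classic y ->
    `|partial1of2 F x y| <= (fun=> `|M| + 1) y.
  move=> /inI[ax xr]; rewrite /= in_itv/= => hy.
  by rewrite p1E//; apply: HM => //; rewrite (ltW ax) (ltW xr).
have h6 (y : R) : 0 <= (fun=> `|M| + 1) y by rewrite addr_ge0.
have mI : measurable (`[0, 2 * pi] : set (measurableTypeR R)) by [].
have := derivable_under_integral mI h1 h2 h3 h6 h4 h5.
have := differentiation_under_integral mI h1 h2 h3 h6 h4 h5.
rewrite derive1E => e d; apply: DeriveDef => //.
rewrite /circ e; apply: eq_Rintegral => y _ /=.
exact: p1E.
Qed.

End CircleMean.

(** * One-variable calculus and symmetry of mixed derivatives *)

Section Derivatives.
Context {R : realType}.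
Implicit Types (f g df : R -> R) (x a b c r : R).

Lemma der_eq f x a b : is_derive x 1 f a -> a = b -> is_derive x 1 f b.
Proof. by move=> h <-. Qed.

Lemma derD f g x a b : is_derive x 1 f a -> is_derive x 1 g b ->
  is_derive x 1 (fun y => f y + g y) (a + b).
Proof. by move=> df dg; exact: (@is_deriveD _ _ _ f g). Qed.

Lemma derN f x a : is_derive x 1 f a -> is_derive x 1 (fun y => - f y) (- a).
Proof. by move=> df; exact: (@is_deriveN _ _ _ f). Qed.

Lemma derM f g x a b : is_derive x 1 f a -> is_derive x 1 g b ->
  is_derive x 1 (fun y => f y * g y) (a * g x + f x * b).
Proof.
move=> df dg; apply: (der_eq (@is_deriveM _ _ f g _ _ _ _ df dg)).
by rewrite /GRing.scale/= addrC mulrC [f x * _]mulrC [b * _]mulrC.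
Qed.

Lemma derC c x : is_derive x 1 (fun=> c) 0.
Proof. exact: is_derive_cst. Qed.

Lemma derI x : is_derive x 1 (fun y => y) 1.
Proof. exact: is_derive_id. Qed.

Lemma mean_value f df R0 a b : (forall r : R, R0 < r -> is_derive r 1 f (df r)) ->
  R0 < a -> a < b -> exists2 c, a < c < b & f b - f a = df c * (b - a).
Proof.
move=> d Ra ab.
have [||c] := @MVT _ f df a b ab.
- by move=> x; rewrite in_itv/= => /andP[ax _]; apply: d; lra.
- apply: derivable_within_continuous => x; rewrite in_itv/= => /andP[ax _].
  by have [] := d x (lt_le_trans Ra ax).
- by rewrite in_itv/= => ? ?; exists c.
Qed.

Lemma nonincreasing_of_der f df R0 : (forall r : R, R0 < r -> is_derive r 1 f (df r)) ->
  (forall r, R0 < r -> df r <= 0) ->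
  forall x y, R0 < x -> x <= y -> f y <= f x.
Proof.
move=> d d0 x y Rx; rewrite le_eqVlt => /predU1P[->//|xy].
have [c /andP[xc cy] e] := mean_value d Rx xy.
rewrite -subr_le0 e mulr_le0_ge0//; first by apply: d0; lra.
by lra.
Qed.

End Derivatives.

(** Differentiates an expression syntactically; facts about its atoms are taken
    from the context. *)
Ltac der := repeat first
  [ eassumption | apply derD | apply derN | apply derM
  | apply derC | apply derI ].

Section Schwarz.
Context {R : realType}.
Variables (R0 : R) (F Fr Ft Frt Ftr : R -> R -> R).
Hypothesis d_r : forall r t : R, R0 < r -> is_derive r 1 (F^~ t) (Fr r t).
Hypothesis d_t : forall r t : R, R0 < r -> is_derive t 1 (F r) (Ft r t).
Hypothesis d_rt : forall r t : R, R0 < r -> is_derive t 1 (Fr r) (Frt r t).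
Hypothesis d_tr : forall r t : R, R0 < r -> is_derive r 1 (Ft^~ t) (Ftr r t).
Hypotheses (c_rt : jcont R0 Frt) (c_tr : jcont R0 Ftr).

(** Continuity at a point, tested on a quadrant only. *)
Lemma jcont_close G r t e : jcont R0 G -> R0 < r -> 0 < e ->
  exists2 h : R, 0 < h & forall x y, r < x < r + h -> t < y < t + h ->
    `|G r t - G x y| < e.
Proof.
move=> jG Rr e0; have /cvgrPdist_lt/(_ _ e0) := jG r t Rr.
case=> -[A B] [[da /= da0 hA] [db /= db0 hB]] AB.
exists (Num.min da db); first by rewrite lt_min da0.
move=> x y /andP[rx xr] /andP[ty yt].
apply: (AB (x, y)); split => /=; [apply: hA|apply: hB] => /=.
- rewrite distrC ger0_norm; last by lra.
  by rewrite ltrBlDl (lt_le_trans xr)// lerD2l ge_min lexx.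
- rewrite distrC ger0_norm; last by lra.
  by rewrite ltrBlDl (lt_le_trans yt)// lerD2l ge_min lexx orbT.
Qed.

(** Equality of mixed partial derivatives. *)
Lemma schwarz r t : R0 < r -> Frt r t = Ftr r t.
Proof.
move=> Rr; apply/eqP/negPn/negP => ne.
pose e := `|Frt r t - Ftr r t| / 2.
have e0 : 0 < e by rewrite /e divr_gt0// normr_gt0 subr_eq0.
have [h1 h10 H1] := jcont_close t c_rt Rr e0.
have [h2 h20 H2] := jcont_close t c_tr Rr e0.
pose h := Num.min h1 h2.
have h0 : 0 < h by rewrite lt_min h10.
have hh1 : h <= h1 by rewrite ge_min lexx.
have hh2 : h <= h2 by rewrite ge_min lexx orbT.
have rh : r < r + h by lra.
have th : t < t + h by lra.
(* the second difference over a small square equals h^2 times either mixed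
   derivative at some point of the square *)
have [x xi e1] : exists2 c, r < c < r + h & (F (r + h) (t + h) - F (r + h) t) -
    (F r (t + h) - F r t) = (Fr c (t + h) - Fr c t) * (r + h - r).
  apply: (@mean_value _ (fun r => F r (t + h) - F r t)
    (fun r => Fr r (t + h) - Fr r t) R0) => // z Rz.
  by apply: derD; [exact: d_r|apply: derN; exact: d_r].
have [y yi e2] : exists2 c, t < c < t + h & (F (r + h) (t + h) - F r (t + h)) -
    (F (r + h) t - F r t) = (Ft (r + h) c - Ft r c) * (t + h - t).
  apply: (@mean_value _ (fun t => F (r + h) t - F r t)
    (fun t => Ft (r + h) t - Ft r t) (t - 1)) => [z _||//]; last by lra.
  by apply: derD; [apply: d_t; lra|apply: derN; exact: d_t].
have Rx : R0 < x by case/andP: xi; lra.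
have [y' yi' e1'] : exists2 c, t < c < t + h &
    Fr x (t + h) - Fr x t = Frt x c * (t + h - t).
  by apply: (@mean_value _ (Fr x) _ (t - 1)) => [z _||//]; [exact: d_rt|lra].
have [x' xi' e2'] : exists2 c, r < c < r + h &
    Ft (r + h) y - Ft r y = Ftr c y * (r + h - r).
  by apply: (@mean_value _ (Ft^~ y) (Ftr^~ y) R0) => // z Rz; exact: d_tr.
have E : Frt x y' = Ftr x' y.
  apply: (@mulIf _ (h * h)); first by rewrite mulf_neq0// gt_eqF.
  have E1 : Frt x y' * (h * h) = F (r + h) (t + h) - F (r + h) t - (F r (t + h) - F r t).
    by rewrite e1 e1'; ring.
  have E2 : Ftr x' y * (h * h) = F (r + h) (t + h) - F r (t + h) - (F (r + h) t - F r t).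
    by rewrite e2 e2'; ring.
  by rewrite E1 E2; ring.
have A1 : `|Frt r t - Frt x y'| < e by apply: H1; apply/andP; lra.
have A2 : `|Ftr r t - Ftr x' y| < e by apply: H2; apply/andP; lra.
have : `|Frt r t - Ftr r t| < e + e.
  rewrite (_ : Frt r t - Ftr r t = (Frt r t - Frt x y') - (Ftr r t - Ftr x' y)).
    by rewrite (le_lt_trans (ler_normB _ _))// ltrD.
  by rewrite E; ring.
by rewrite /e; lra.
Qed.

End Schwarz.

(** * Solutions in polar coordinates and their energies *)

(** A real solution of [Delta f = kap f] outside the disc of radius [R0], as a
    twice continuously differentiable function of the polar coordinates: the
    function, its partial derivatives in the radius [r] and the angle [t], the
    agreement at the angles 0 and 2 pi, and the polar form of the equation. *)
Record wave (R : realType) (R0 kap : R) := Wave {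
  wf :> R -> R -> R;
  w_r : R -> R -> R; w_t : R -> R -> R;
  w_rr : R -> R -> R; w_rt : R -> R -> R; w_tt : R -> R -> R;
  wd_r : forall r t : R, R0 < r -> is_derive r 1 (wf^~ t) (w_r r t);
  wd_t : forall r t : R, R0 < r -> is_derive t 1 (wf r) (w_t r t);
  wd_rr : forall r t : R, R0 < r -> is_derive r 1 (w_r^~ t) (w_rr r t);
  wd_rt : forall r t : R, R0 < r -> is_derive t 1 (w_r r) (w_rt r t);
  wd_tr : forall r t : R, R0 < r -> is_derive r 1 (w_t^~ t) (w_rt r t);
  wd_tt : forall r t : R, R0 < r -> is_derive t 1 (w_t r) (w_tt r t);
  wc : jcont R0 wf; wc_r : jcont R0 w_r; wc_t : jcont R0 w_t;
  wc_rr : jcont R0 w_rr; wc_rt : jcont R0 w_rt; wc_tt : jcont R0 w_tt;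
  w_per : forall r, R0 < r -> wf r (2 * pi) = wf r 0;
  w_per_r : forall r, R0 < r -> w_r r (2 * pi) = w_r r 0;
  w_per_t : forall r, R0 < r -> w_t r (2 * pi) = w_t r 0;
  w_eq : forall r t, R0 < r ->
    w_rr r t = kap * wf r t - w_r r t / r - w_tt r t / (r * r) }.

Arguments wd_r {R R0 kap}.
Arguments wd_t {R R0 kap}.
Arguments wd_rr {R R0 kap}.
Arguments wd_rt {R R0 kap}.
Arguments wd_tr {R R0 kap}.
Arguments wd_tt {R R0 kap}.
Arguments wc {R R0 kap}.
Arguments wc_r {R R0 kap}.
Arguments wc_t {R R0 kap}.
Arguments wc_rr {R R0 kap}.
Arguments wc_rt {R R0 kap}.
Arguments wc_tt {R R0 kap}.
Arguments w_per {R R0 kap}.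
Arguments w_per_r {R R0 kap}.
Arguments w_per_t {R R0 kap}.
Arguments w_eq {R R0 kap}.

Section Waves.
Context {R : realType}.

(** Inner product over the circle, as a function of the radius. *)
Definition ip (F G : R -> R -> R) (r : R) := circ (fun t => F r t * G r t).

Lemma ipC F G r : ip F G r = ip G F r.
Proof. by rewrite /ip; congr circ; apply/funext => t; rewrite mulrC. Qed.

Lemma ip_ge0 F r : 0 <= ip F F r.
Proof. by apply: circ_ge0 => t; rewrite -expr2 sqr_ge0. Qed.

Section IP.
Variables (R0 : R) (F F' G G' : R -> R -> R) (r : R).
Hypotheses (cF : jcont R0 F) (cG : jcont R0 G) (Rr : R0 < r).

Lemma cont_ip : continuous (fun t => F r t * G r t).
Proof. exact: (jcont_sect (jcontM cF cG) Rr). Qed.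

Lemma ip_der :
  (forall r t : R, R0 < r -> is_derive r 1 (F^~ t) (F' r t)) ->
  (forall r t : R, R0 < r -> is_derive r 1 (G^~ t) (G' r t)) ->
  jcont R0 F' -> jcont R0 G' ->
  is_derive r 1 (ip F G) (ip F' G r + ip F G' r).
Proof.
move=> dF dG cF' cG'; rewrite /ip -circD; last 2 first.
- exact: (jcont_sect (jcontM cF' cG) Rr).
- exact: (jcont_sect (jcontM cF cG') Rr).
apply: (@circ_derive _ R0 (fun r t => F r t * G r t)
  (fun r t => F' r t * G r t + F r t * G' r t)) => //.
- by move=> x t Rx; apply: derM; [exact: dF|exact: dG].
- exact: jcontM.
- by apply: jcontD; exact: jcontM.
Qed.

End IP.

Section OneWave.
Variables (R0 kap : R) (R0_ge0 : 0 <= R0) (f : wave R0 kap).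

(** The equation tested against [h], the angular term being integrated by
    parts over the circle. *)
Lemma ip_rr (h h' : R -> R -> R) r : R0 < r ->
  (forall t : R, is_derive t 1 (h r) (h' r t)) -> h r (2 * pi) = h r 0 ->
  jcont R0 h -> jcont R0 h' ->
  ip (w_rr f) h r = kap * ip f h r - ip (w_r f) h r / r + ip (w_t f) h' r / (r * r).
Proof.
move=> Rr dh ph ch ch'.
have r0 : r != 0 by rewrite gt_eqF// (le_lt_trans R0_ge0).
have cM F G (cF : jcont R0 F) (cG : jcont R0 G) := cont_ip cF cG Rr.
have c1 := cM _ _ (wc f) ch.
have c2 := cM _ _ (wc_r f) ch.
have c3 := cM _ _ (wc_t f) ch'.
have c4 := cM _ _ (wc_tt f) ch.
have c5 : continuous (fun t => kap * (f r t * h r t)).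
  by apply: contM; [exact: contC|exact: c1].
have c6 : continuous (fun t => - r^-1 * (w_r f r t * h r t)).
  by apply: contM; [exact: contC|exact: c2].
have c7 : continuous (fun t => - (r * r)^-1 * (w_tt f r t * h r t)).
  by apply: contM; [exact: contC|exact: c4].
have c56 : continuous (fun t => kap * (f r t * h r t) + - r^-1 * (w_r f r t * h r t)).
  by apply: contD; [exact: c5|exact: c6].
have E : ip (w_tt f) h r = - ip (w_t f) h' r.
  apply/eqP; rewrite -addr_eq0 /ip -circD//.
  have dG (t : R) : is_derive t 1 (fun t => w_t f r t * h r t)
      (w_tt f r t * h r t + w_t f r t * h' r t).
    exact: derM (wd_tt f r t Rr) (dh t).
  rewrite (circ_FTC dG); last by apply: contD; [exact: c4|exact: c3].
  by rewrite ph w_per_t// subrr.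
transitivity (kap * ip f h r + - r^-1 * ip (w_r f) h r + - (r * r)^-1 * ip (w_tt f) h r).
  rewrite /ip -!circZ// -!circD//.
  by congr circ; apply/funext => t; rewrite w_eq//; field.
by rewrite E; field.
Qed.

(** The energies attached to a solution [f], over the circle of radius [r]:
    [wN = |f|^2], [wQ = f_r f], [wP = |f_r|^2], [wT = |f_t|^2], [wX = f_rt f_t],
    all integrated in the angle. *)
Definition wN := ip f f.
Definition wQ := ip (w_r f) f.
Definition wP := ip (w_r f) (w_r f).
Definition wT := ip (w_t f) (w_t f).
Definition wX := ip (w_rt f) (w_t f).

Lemma der_wN r : R0 < r -> is_derive r 1 wN (2 * wQ r).
Proof.
move=> Rr; have := ip_der (wc f) (wc f) Rr (wd_r f) (wd_r f)
  (wc_r f) (wc_r f).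
by move/der_eq; apply; rewrite [ip f _ _]ipC /wQ; ring.
Qed.

Lemma der_wQ r : R0 < r ->
  is_derive r 1 wQ (wP r + kap * wN r - wQ r / r + wT r / (r * r)).
Proof.
move=> Rr; have := ip_der (wc_r f) (wc f) Rr (wd_rr f) (wd_r f)
  (wc_rr f) (wc_r f).
move/der_eq; apply; rewrite (ip_rr Rr (fun t => wd_t f r t Rr) (w_per f r Rr) (wc f) (wc_t f)).
by rewrite /wP/wQ/wT/wN; ring.
Qed.

Lemma der_wP r : R0 < r ->
  is_derive r 1 wP (2 * (kap * wQ r - wP r / r + wX r / (r * r))).
Proof.
move=> Rr; have := ip_der (wc_r f) (wc_r f) Rr (wd_rr f)
  (wd_rr f) (wc_rr f) (wc_rr f).
move/der_eq; apply; rewrite [ip (w_r f) (w_rr f) r]ipC (ip_rr Rr (fun t => wd_rt f r t Rr) (w_per_r f r Rr) (wc_r f) (wc_rt f)).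
by rewrite /wP/wQ/wX [ip f (w_r f) r]ipC [ip (w_rt f) _ _]ipC; ring.
Qed.

Lemma der_wT r : R0 < r -> is_derive r 1 wT (2 * wX r).
Proof.
move=> Rr; have := ip_der (wc_t f) (wc_t f) Rr (wd_tr f)
  (wd_tr f) (wc_rt f) (wc_rt f).
by move/der_eq; apply; rewrite [ip (w_t f) (w_rt f) r]ipC /wX; ring.
Qed.

Lemma wQ_le r : R0 < r -> wQ r <= (wP r + wN r) / 2.
Proof.
move=> Rr; have cM F G (cF : jcont R0 F) (cG : jcont R0 G) := cont_ip cF cG Rr.
have c1 := cM _ _ (wc f) (wc f).
have c2 := cM _ _ (wc_r f) (wc f).
have c3 := cM _ _ (wc_r f) (wc_r f).
have cs : continuous (fun t => w_r f r t * w_r f r t + f r t * f r t).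
  by apply: contD; [exact: c3|exact: c1].
rewrite /wQ /wP /wN /ip -circD// mulrC -circZ//; apply: circ_le => //.
  by apply: contM; [exact: contC|exact: cs].
move=> t _; have := sqr_ge0 (w_r f r t - f r t); nra.
Qed.

(** One-dimensional Sobolev inequality with a free weight [m]. It results from
    integrating the derivative of [t f^2] over a period. *)
Lemma sup_bound r m : R0 < r -> 0 < m ->
  f r 0 ^+ 2 <= wN r + m * r * wN r + wT r / (r * m).
Proof.
move=> Rr m0.
have r0 : 0 < r := le_lt_trans R0_ge0 Rr.
have rm0 : 0 < r * m by rewrite mulr_gt0.
have rm1 : r * m != 0 by rewrite gt_eqF.
have pi2 := @pi_ge2 R.
have cM F G (cF : jcont R0 F) (cG : jcont R0 G) := cont_ip cF cG Rr.
have c1 := cM _ _ (wc f) (wc f).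
have c2 := cM _ _ (wc_t f) (wc f).
have c3 := cM _ _ (wc_t f) (wc_t f).
have cg : continuous (fun t => f r t * f r t + t * (2 * (w_t f r t * f r t))).
  apply: contD; first exact: c1.
  apply: contM; first exact: contI.
  by apply: contM; [exact: contC|exact: c2].
have cA : continuous (fun t => (1 + 2 * pi * (r * m)) * (f r t * f r t)).
  by apply: contM; [exact: contC|exact: c1].
have cB : continuous (fun t => 2 * pi / (r * m) * (w_t f r t * w_t f r t)).
  by apply: contM; [exact: contC|exact: c3].
have E : circ (fun t => f r t * f r t + t * (2 * (w_t f r t * f r t))) = 2 * pi * f r 0 ^+ 2.
  have dG (t : R) : is_derive t 1 (fun t => t * (f r t * f r t))
      (f r t * f r t + t * (2 * (w_t f r t * f r t))).
    have d := wd_t f r t Rr.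
    by eapply der_eq; [der|cbn beta; ring].
  by rewrite (circ_FTC dG)// mul0r subr0 w_per// expr2.
have L : circ (fun t => f r t * f r t + t * (2 * (w_t f r t * f r t))) <=
    circ (fun t => (1 + 2 * pi * (r * m)) * (f r t * f r t) +
      2 * pi / (r * m) * (w_t f r t * w_t f r t)).
  apply: circ_le => //.
    by apply: contD; [exact: cA|exact: cB].
  move=> t /andP[t0 t2].
  set x := f r t; set y := w_t f r t.
  have h : 2 * `|x * y| <= r * m * (x * x) + (y * y) / (r * m).
    rewrite normrM; set X := `|x|; set Y := `|y|.
    have -> : x * x = X * X by rewrite -!expr2 real_normK ?num_real.
    have -> : y * y = Y * Y by rewrite -!expr2 real_normK ?num_real.
    rewrite -subr_ge0 (_ : _ - _ = (r * m * X - Y) ^+ 2 / (r * m)); last by field; rewrite !gt_eqF.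
    by rewrite divr_ge0// ?sqr_ge0 // ltW.
  have h2 : t * (2 * (y * x)) <= 2 * pi * (2 * `|x * y|).
    rewrite (le_trans (ler_norm _))// normrM (ger0_norm t0) normrM.
    rewrite [`|2|]ger0_norm// [y * x]mulrC ler_pM//.
  have h3 : 2 * pi * (2 * `|x * y|) <= 2 * pi * (r * m * (x * x) + y * y / (r * m)).
    by rewrite ler_pM2l// twopi_gt0.
  rewrite [leRHS](_ : _ = x * x + 2 * pi * (r * m * (x * x) + y * y / (r * m))).
    by rewrite lerD2l; exact: le_trans h3.
  by field; rewrite !gt_eqF.
move: L; rewrite E circD// !circZ// -/(ip f f r) -/(ip (w_t f) (w_t f) r) -/(wN r) -/(wT r) => L.
have p0 : 0 < 2 * pi :> R := twopi_gt0.
have N0 : 0 <= wN r := ip_ge0 _ _.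
rewrite -(ler_pM2l p0); apply: (le_trans L).
rewrite [leRHS](_ : _ = (1 + 2 * pi * (r * m)) * wN r + 2 * pi / (r * m) * wT r +
  (2 * pi - 1) * wN r); last by field; rewrite !gt_eqF.
by rewrite lerDl mulr_ge0//; lra.
Qed.

End OneWave.
End Waves.

(** * Conserved and monotone quantities *)

(** A second difference with steps 1 and 2 is a value of the second derivative
    times a factor at least 1. *)
Lemma second_difference (R : realType) (R0 : R) (m m' m'' : R -> R) (r : R) :
  (forall x : R, R0 < x -> is_derive x 1 m (m' x)) ->
  (forall x : R, R0 < x -> is_derive x 1 m' (m'' x)) -> R0 + 3 < r ->
  exists2 x, r - 3 < x < r & exists2 c, 1 <= c &
    m r - m (r - 1) - (m (r - 2) - m (r - 3)) = m'' x * c.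
Proof.
move=> d1 d2 Rr.
have [y hy ey] : exists2 c, r - 1 < c < r & m r - m (r - 1) = m' c * (r - (r - 1)).
  by apply: (mean_value d1); lra.
have [z hz ez] : exists2 c, r - 3 < c < r - 2 &
    m (r - 2) - m (r - 3) = m' c * (r - 2 - (r - 3)) by apply: (mean_value d1); lra.
have [x hx ex] : exists2 c, z < c < y & m' y - m' z = m'' c * (y - z).
  by apply: (mean_value d2); lra.
exists x; first by lra.
by exists (y - z); [lra|rewrite ey ez -ex; ring].
Qed.

(** The right-hand side is the second derivative of the squared norm of a
    solution of [Delta f = kk f]; it dominates the norms of [f_r] and [f]. *)
Lemma curvature_lower_bound (R : realType) (kk x P N Q T : R) : 0 < kk -> 1 < x -> kk^-1 < x ->
  0 <= P -> 0 <= N -> 0 <= T -> Q <= (P + N) / 2 ->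
  P + kk * N <= 2 * (P + kk * N - Q / x + T / (x * x)).
Proof.
move=> kk0 x1 xk P0 N0 T0 QPN; have x0 : 0 < x by lra.
have T1 : 0 <= T / (x * x) by rewrite divr_ge0// mulr_ge0// ltW.
have : Q / x <= (P + kk * N) / 2.
  rewrite ler_pdivrMr//.
  have s1 : P <= P * x by rewrite ler_peMr// ltW.
  have s2 : N <= kk * N * x.
    rewrite -mulrA [N * x]mulrC mulrA ler_peMl//.
    by rewrite -ler_pdivrMl// mulr1 ltW.
  by lra.
by lra.
Qed.

(** [m0] and [m3] stand for squared norms at the radii [r] and [r - 3]. *)
Lemma window_bound (R : realType) (e r x L m0 m3 : R) : 6 < r -> 0 <= x -> x <= r ->
  0 <= L -> L <= m0 + m3 -> 0 <= m3 -> r * m0 <= e / 3 -> (r - 3) * m3 <= e / 3 ->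
  x * L <= e.
Proof.
move=> r6 x0 xr L0 Lm m30 M1 M2.
have r0 : 0 <= r by lra.
have h1 : x * L <= r * (m0 + m3) by apply: ler_pM.
have h2 : r <= 2 * (r - 3) by lra.
have h3 : r * m3 <= 2 * (r - 3) * m3 by rewrite ler_wpM2r.
by lra.
Qed.

Section Decay.
Context {R : realType}.
Variables (R0 k : R).
Hypotheses (R0_ge0 : 0 <= R0) (k_gt0 : 0 < k).

(** [Im <U_r, U>] for the complex solution [U = a + i b]. *)
Definition wV kap (a b : wave R0 kap) (r : R) := ip (w_r b) a r - ip (w_r a) b r.

Lemma wave_gt0 r : R0 < r -> 0 < r.
Proof. exact: le_lt_trans. Qed.

Lemma der_wV kap (a b : wave R0 kap) r : R0 < r ->
  is_derive r 1 (wV a b) (- wV a b r / r).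
Proof.
move=> Rr.
have d1 := ip_der (wc_r b) (wc a) Rr (wd_rr b) (wd_r a) (wc_rr b) (wc_r a).
have d2 := ip_der (wc_r a) (wc b) Rr (wd_rr a) (wd_r b) (wc_rr a) (wc_r b).
apply: (der_eq (derD d1 (derN d2))).
rewrite (ip_rr R0_ge0 b Rr (fun t => wd_t a r t Rr) (w_per a r Rr) (wc a) (wc_t a)).
rewrite (ip_rr R0_ge0 a Rr (fun t => wd_t b r t Rr) (w_per b r Rr) (wc b) (wc_t b)).
rewrite [ip (w_t b) _ _]ipC [ip a b _]ipC [ip (w_r b) (w_r a) _]ipC /wV.
by field; rewrite gt_eqF// wave_gt0.
Qed.

(** Conservation of the flux through circles. *)
Lemma wV_const kap (a b : wave R0 kap) r s : R0 < r -> R0 < s ->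
  r * wV a b r = s * wV a b s.
Proof.
have D z : R0 < z -> is_derive z 1 (fun r => r * wV a b r) 0.
  move=> Rz; have d := der_wV a b Rz; eapply der_eq; first by der.
  by cbn beta; field; rewrite gt_eqF// wave_gt0.
have N z : R0 < z -> is_derive z 1 (fun r => - (r * wV a b r)) 0.
  by move=> Rz; apply: (der_eq (derN (D _ Rz))); rewrite oppr0.
have le x y : R0 < x -> x <= y -> x * wV a b x = y * wV a b y.
  move=> Rx xy; apply/eqP; rewrite eq_le; apply/andP; split.
    by rewrite -lerN2; apply: (nonincreasing_of_der N).
  exact: (nonincreasing_of_der D).
move=> Rr Rs; have [rs|sr] := leP r s; first exact: le.
by apply/esym/le => //; exact: ltW.
Qed.

(** The squared norm of [c1 U_r + c0 U - i c2 U] for [U = a + i b]. *)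
Lemma wave_quad kap (a b : wave R0 kap) (c0 c1 c2 : R) r : R0 < r ->
  circ (fun t => (c1 * w_r a r t + c0 * a r t + c2 * b r t) ^+ 2 +
                 (c1 * w_r b r t + c0 * b r t - c2 * a r t) ^+ 2) =
  c1 * c1 * (wP a r + wP b r) + 2 * c0 * c1 * (wQ a r + wQ b r)
     + (c0 * c0 + c2 * c2) * (wN a r + wN b r) - 2 * c1 * c2 * wV a b r.
Proof.
move=> Rr.
have cM F G (cF : jcont R0 F) (cG : jcont R0 G) := cont_ip cF cG Rr.
have caa := cM _ _ (wc a) (wc a).
have cbb := cM _ _ (wc b) (wc b).
have cPa := cM _ _ (wc_r a) (wc_r a).
have cPb := cM _ _ (wc_r b) (wc_r b).
have cQa := cM _ _ (wc_r a) (wc a).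
have cQb := cM _ _ (wc_r b) (wc b).
have cab := cM _ _ (wc_r a) (wc b).
have cba := cM _ _ (wc_r b) (wc a).
have cZ (c : R) (f : R -> R) : continuous f -> continuous (fun t => c * f t).
  by apply: contM; exact: contC.
rewrite [in LHS](_ : (fun t => _) = fun t =>
   c1 * c1 * (w_r a r t * w_r a r t + w_r b r t * w_r b r t) +
   (2 * c0 * c1 * (w_r a r t * a r t + w_r b r t * b r t) +
   ((c0 * c0 + c2 * c2) * (a r t * a r t + b r t * b r t) +
    (- (2 * c1 * c2)) * (w_r b r t * a r t + (-1) * (w_r a r t * b r t))))); last first.
  by apply/funext => t; ring.
have k1 := contD cPa cPb.
have k2 := contD cQa cQb.
have k3 := contD caa cbb.
have k4 := contD cba (cZ (-1) _ cab).
have z1 := cZ (c1 * c1) _ k1. have z2 := cZ (2 * c0 * c1) _ k2.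
have z3 := cZ (c0 * c0 + c2 * c2) _ k3. have z4 := cZ (- (2 * c1 * c2)) _ k4.
rewrite (circD z1 (contD z2 (contD z3 z4))) (circD z2 (contD z3 z4)) (circD z3 z4).
rewrite (circZ _ k1) (circZ _ k2) (circZ _ k3) (circZ _ k4).
rewrite (circD cPa cPb) (circD cQa cQb) (circD caa cbb) (circD cba (cZ (-1) _ cab)) (circZ _ cab).
by rewrite /wP /wQ /wN /wV /ip; ring.
Qed.

Lemma wave_quad_ge0 kap (a b : wave R0 kap) (c0 c1 c2 : R) r : R0 < r ->
  0 <= c1 * c1 * (wP a r + wP b r) + 2 * c0 * c1 * (wQ a r + wQ b r)
     + (c0 * c0 + c2 * c2) * (wN a r + wN b r) - 2 * c1 * c2 * wV a b r.
Proof.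
move=> Rr; rewrite -wave_quad//; apply: circ_ge0 => t.
by rewrite addr_ge0// sqr_ge0.
Qed.

(** The monotone energy of a complex solution [a + i b] of the Helmholtz
    equation: with [v = sqrt r (a + i b)], it is [r^2] times the difference
    between [2 k r wV] and [|v_r|^2 + k^2 |v|^2 - (|v_t|^2 - |v|^2 / 4) / r^2]. *)
Definition wH (a b : wave R0 (- (k * k))) (r : R) :=
  2 * k * (r * (r * (r * wV a b r))) - r * (r * (r * (wP a r + wP b r)))
  - r * (r * (wQ a r + wQ b r)) - r * (wN a r + wN b r) / 2
  - k * k * (r * (r * (r * (wN a r + wN b r)))) + r * (wT a r + wT b r).

(** Its derivative is [- 2 || r U_r + U / 2 - i k r U ||^2]. *)
Lemma wH_noninc (a b : wave R0 (- (k * k))) r s : R0 < r -> r <= s ->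
  wH a b s <= wH a b r.
Proof.
pose dH r := - 2 * (r * r * (wP a r + wP b r) + 2 * 2^-1 * r * (wQ a r + wQ b r)
     + (2^-1 * 2^-1 + (k * r) * (k * r)) * (wN a r + wN b r) - 2 * r * (k * r) * wV a b r).
apply: (@nonincreasing_of_der _ _ dH) => z Rz; last first.
  rewrite /dH mulNr oppr_le0 mulr_ge0//; exact: wave_quad_ge0.
have z0 : z != 0 by rewrite gt_eqF// wave_gt0.
have d1 := der_wV a b Rz.
have dNa := der_wN a Rz. have dNb := der_wN b Rz.
have dQa := der_wQ R0_ge0 a Rz. have dQb := der_wQ R0_ge0 b Rz.
have dPa := der_wP R0_ge0 a Rz. have dPb := der_wP R0_ge0 b Rz.
have dTa := der_wT a Rz. have dTb := der_wT b Rz.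
rewrite /wH; eapply der_eq; first by der.
by rewrite /dH; cbn beta; field.
Qed.

(** The radiation defect of the Helmholtz part [a1 + i b1], in terms of a bound
    [e] for that of the sum and of the energies of [a2 + i b2]. *)
Lemma cross_bound (a1 b1 : wave R0 (- (k * k))) (a2 b2 : wave R0 (k * k)) r e :
  R0 < r ->
  (forall t, r * ((w_r a1 r t + w_r a2 r t + k * (b1 r t + b2 r t)) ^+ 2 +
    (w_r b1 r t + w_r b2 r t - k * (a1 r t + a2 r t)) ^+ 2) <= e) ->
  r * (wP a1 r + wP b1 r + k * k * (wN a1 r + wN b1 r) - 2 * k * wV a1 b1 r) <=
    4 * pi * e + 4 * (r * (wP a2 r + wP b2 r + k * k * (wN a2 r + wN b2 r))).
Proof.
move=> Rr h; have r0 := wave_gt0 Rr.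
have cM F G (cF : jcont R0 F) (cG : jcont R0 G) := cont_ip cF cG Rr.
have cZ (c : R) (f : R -> R) : continuous f -> continuous (fun t => c * f t).
  by apply: contM; exact: contC.
have q1 := wave_quad a1 b1 0 1 k Rr.
rewrite (_ : _ - _ = circ (fun t => (1 * w_r a1 r t + 0 * a1 r t + k * b1 r t) ^+ 2 +
  (1 * w_r b1 r t + 0 * b1 r t - k * a1 r t) ^+ 2)); last by rewrite q1; ring.
have cX : continuous (fun t => (1 * w_r a1 r t + 0 * a1 r t + k * b1 r t) ^+ 2 +
  (1 * w_r b1 r t + 0 * b1 r t - k * a1 r t) ^+ 2).
  pose p t := 1 * w_r a1 r t + 0 * a1 r t + k * b1 r t.
  pose q t := 1 * w_r b1 r t + 0 * b1 r t + (- k) * a1 r t.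
  have s1 : continuous p.
    apply: contD; first apply: contD; apply: cZ.
    - exact: (jcont_sect (wc_r a1)).
    - exact: (jcont_sect (wc a1)).
    - exact: (jcont_sect (wc b1)).
  have s2 : continuous q.
    apply: contD; first apply: contD; apply: cZ.
    - exact: (jcont_sect (wc_r b1)).
    - exact: (jcont_sect (wc b1)).
    - exact: (jcont_sect (wc a1)).
  rewrite (_ : (fun t => _) = fun t => p t * p t + q t * q t).
    exact: contD (contM s1 s1) (contM s2 s2).
  by apply/funext => t; rewrite /p /q; ring.
rewrite -circZ//.
have caa := cM _ _ (wc a2) (wc a2).
have cbb := cM _ _ (wc b2) (wc b2).
have cPa := cM _ _ (wc_r a2) (wc_r a2).
have cPb := cM _ _ (wc_r b2) (wc_r b2).
have k1 := contD cPa cPb.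
have k3 := contD caa cbb.
have k4 := contD k1 (cZ (k * k) _ k3).
have k5 := cZ (4 * r) _ k4.
have k6 := contD (@contC _ (2 * e)) k5.
rewrite [leRHS](_ : _ = circ (fun t => 2 * e + 4 * r *
  ((w_r a2 r t * w_r a2 r t + w_r b2 r t * w_r b2 r t) +
   k * k * (a2 r t * a2 r t + b2 r t * b2 r t)))); last first.
  have cc : continuous (fun _ : R => 2 * e) := @contC _ _.
  rewrite (circD cc k5) (circZ _ k4) (circD k1 (cZ _ _ k3)) (circZ _ k3).
  by rewrite (circD cPa cPb) (circD caa cbb) circ_cst /wP /wN /ip; ring.
apply: circ_le => //; first exact: cZ.
move=> t _; have ht := h t.
set x := w_r a1 r t in ht *; set y := b1 r t in ht *; set z := w_r a2 r t in ht *.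
set u := b2 r t in ht *; set x' := w_r b1 r t in ht *; set y' := a1 r t in ht *.
set z' := w_r b2 r t in ht *; set u' := a2 r t in ht *.
(* |p|^2 <= 2|p + q|^2 + 2|q|^2 and |z - i k v|^2 <= 2|z|^2 + 2 k^2 |v|^2 *)
have e1 : (1 * x + 0 * y' + k * y) ^+ 2 + (1 * x' + 0 * y - k * y') ^+ 2 <=
  2 * ((x + z + k * (y + u)) ^+ 2 + (x' + z' - k * (y' + u')) ^+ 2) +
  4 * (z * z + z' * z' + k * k * (u' * u' + u * u)).
  rewrite -subr_ge0.
  rewrite [X in 0 <= X](_ : _ = (x + k * y + 2 * (z + k * u)) ^+ 2 +
    (x' - k * y' + 2 * (z' - k * u')) ^+ 2 + 2 * (z - k * u) ^+ 2 + 2 * (z' + k * u') ^+ 2); last by ring.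
  by repeat first [exact: sqr_ge0 | by [] | apply: addr_ge0 | apply: mulr_ge0].
rewrite -(ler_pM2l r0) in e1; apply: (le_trans e1).
by lra.
Qed.

(** If [a + i b] decays faster than [r^(-1/2)], then in every interval of length 3
    there is a radius at which its derivative is small too. *)
Lemma good_radius (a b : wave R0 (k * k)) :
  (forall e : R, 0 < e -> \forall r \near +oo, forall t, r * (a r t ^+ 2 + b r t ^+ 2) <= e) ->
  forall e : R, 0 < e -> \forall r \near +oo, exists2 x, r - 3 < x < r &
    x * (wP a x + wP b x + k * k * (wN a x + wN b x)) <= e.
Proof.
move=> h e e0.
pose m r := wN a r + wN b r.
pose D r := 2 * (wP a r + wP b r + k * k * m r - (wQ a r + wQ b r) / r +
   (wT a r + wT b r) / (r * r)).
have dm (r : R) : R0 < r -> is_derive r 1 m (2 * (wQ a r + wQ b r)).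
  move=> Rr; have d1 := der_wN a Rr; have d2 := der_wN b Rr.
  by eapply der_eq; [der|ring].
have dQ (r : R) : R0 < r -> is_derive r 1 (fun r => 2 * (wQ a r + wQ b r)) (D r).
  move=> Rr; have d1 := der_wQ R0_ge0 a Rr; have d2 := der_wQ R0_ge0 b Rr.
  by eapply der_eq; [der|rewrite /D /m; cbn beta; ring].
have p6 : 0 < e / (6 * pi) by rewrite divr_gt0// mulr_gt0// pi_gt0.
have [B [_ HB]] := h _ p6.
have mle (r : R) : R0 < r -> B < r -> r * m r <= e / 3.
  move=> Rr Br; have H := HB _ Br.
  have cN : continuous (fun t => a r t * a r t + b r t * b r t).
    by apply: contD; [exact: cont_ip (wc a) (wc a) Rr|exact: cont_ip (wc b) (wc b) Rr].
  rewrite /m /wN /ip -circD; [|exact: cont_ip (wc a) (wc a) Rr|exact: cont_ip (wc b) (wc b) Rr].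
  rewrite -circZ//; apply: (@le_trans _ _ (circ (fun=> e / (6 * pi)))).
    apply: circ_le; [exact: contM (@contC _ _) cN|exact: contC|].
    by move=> t _; have := H t; rewrite !expr2.
  have pi0 : pi != 0 :> R := lt0r_neq0 (pi_gt0 R).
  have pe (p : R) : p != 0 -> 2 * p * (e / (6 * p)) = e / 3 by move=> p0; field.
  by rewrite circ_cst pe.
near=> r.
have r1 : R0 + 3 < r by near: r; exact/nbhs_pinfty_gt/num_real.
have r2 : B + 3 < r by near: r; exact/nbhs_pinfty_gt/num_real.
have r3 : 6 < r by near: r; exact/nbhs_pinfty_gt/num_real.
have r4 : (k * k)^-1 + 3 < r by near: r; exact/nbhs_pinfty_gt/num_real.
have [x hx [c c1 ex]] := second_difference dm dQ r1.
exists x => //; have /andP[hx1 hx2] := hx.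
have low a' : a' + 3 < r -> a' < r - 3 by rewrite ltrBrDr.
have Rr' := low _ r1. have rB' := low _ r2.
have Rx := lt_trans Rr' hx1. have x0 := le_lt_trans R0_ge0 Rx.
have rB := lt_trans rB' (lt_trans hx1 hx2). have Rr := lt_trans Rx hx2.
have x1 : 1 < x by apply: lt_trans hx1; apply: low; apply: lt_trans r3; lra.
have xk : (k * k)^-1 < x := lt_trans (low _ r4) hx1.
have m0 s : 0 <= m s by rewrite addr_ge0// ip_ge0.
have P0 : 0 <= wP a x + wP b x by rewrite addr_ge0// ip_ge0.
have T0 : 0 <= wT a x + wT b x by rewrite addr_ge0// ip_ge0.
have kk : 0 < k * k by rewrite mulr_gt0.
pose L := wP a x + wP b x + k * k * m x.
have L0 : 0 <= L by rewrite /L addr_ge0// mulr_ge0// ltW.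
have LD : L <= D x.
  apply: curvature_lower_bound => //.
  have := lerD (wQ_le a Rx) (wQ_le b Rx).
  by rewrite -mulrDl addrACA.
have Dle : D x <= m r + m (r - 3).
  have D0 : 0 <= D x := le_trans L0 LD.
  apply: (@le_trans _ _ (D x * c)); first by rewrite ler_peMr.
  rewrite -ex -subr_ge0 (_ : _ - _ = m (r - 1) + m (r - 2)); last by ring.
  exact: addr_ge0.
rewrite -/(m x) -/L.
exact: window_bound r3 (ltW x0) (ltW hx2) L0 (le_trans LD Dle) (m0 _) (mle _ Rr rB) (mle _ Rr' rB').
Unshelve. all: by end_near. Qed.

End Decay.

(** * Decay of radiating solutions *)

(** With [W] standing for [2 k] times the flux [r wV] and [S] for the radiation
    defect [r || U_r - i k U ||^2], [x N] is bounded and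
    [T / x] is at most [S + O(1/x)]. *)
Lemma angular_bound (R : realType) (kk x N P Q T S W H H0 E : R) :
  0 < kk -> 1 < x -> 0 <= N -> 0 <= P -> Q <= (P + N) / 2 ->
  x * P + kk * (x * N) = S + W -> S + W <= E -> H <= H0 -> 0 <= H0 ->
  T / x = H / (x * x) + S + Q + N / (2 * x) ->
  x * N <= E / kk /\ T / x <= S + (H0 + E + E / kk) / x.
Proof.
move=> kk0 x1 N0 P0 QPN PN EE HH H00 TE; have x0 : 0 < x by lra.
have kN0 : 0 <= kk * (x * N) by rewrite !mulr_ge0// ltW.
have xP0 : 0 <= x * P by rewrite mulr_ge0// ltW.
have xP : P <= E / x by rewrite ler_pdivlMr// mulrC; lra.
have xN' : x * N <= E / kk by rewrite ler_pdivlMr// mulrC; lra.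
have xN : N <= E / kk / x by rewrite ler_pdivlMr// mulrC.
have h1 : H / (x * x) <= H0 / x.
  apply: (@le_trans _ _ (H0 / (x * x))).
    by rewrite ler_pM2r// invr_gt0 mulr_gt0.
  by rewrite invfM mulrA ler_pdivrMr// divfK ?gt_eqF// ler_piMr// invf_le1// ltW.
have h2 : N / (2 * x) <= E / kk / x / 2.
  rewrite invfM [2^-1 * _]mulrC mulrA ler_pM2r ?invr_gt0//.
  by apply: le_trans xN; rewrite ler_pdivrMr// ler_peMr// ltW.
have h3 : 0 <= E / x by apply: le_trans xP.
split=> //; rewrite TE [(_ + _ + _) / x]mulrDl [(_ + _) / x]mulrDl.
by lra.
Qed.

(** The three terms of [sup_bound] with weight [m] sum to at most [e]. *)
Lemma balance_bound (R : realType) (e kk m x N T E K s : R) :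
  0 < e -> 0 < kk -> 0 < m -> 0 < x -> 0 < E -> m * (E / kk) = e / 4 ->
  s <= e * m / 4 -> 4 * E / (kk * e) < x -> 4 * K / (m * e) < x ->
  x * N <= E / kk -> T / x <= s + K / x ->
  N + m * (x * N) + T / (x * m) <= e.
Proof.
move=> e0 kk0 m0 x0 E0 mE s2 r3 r4 xN Tx.
have t1 : N <= e / 4.
  rewrite -(ler_pM2l x0); apply: (le_trans xN).
  rewrite (_ : E / kk = e / 4 * (4 * E / (kk * e))); last by field; rewrite !gt_eqF.
  by rewrite [leRHS]mulrC ler_pM2l ?divr_gt0// ltW.
have t2 : m * (x * N) <= e / 4 by rewrite -mE ler_pM2l.
have t3 : T / (x * m) <= e / 2.
  rewrite invfM mulrA ler_pdivrMr// (le_trans Tx)//.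
  have : K / x <= e * m / 4.
    rewrite ler_pdivrMr// (_ : K = e * m / 4 * (4 * K / (m * e))); last by field; rewrite !gt_eqF.
    by rewrite ler_pM2l ?divr_gt0 ?mulr_gt0// ltW.
  by lra.
by lra.
Qed.

(** [a1 + i b1] solves the Helmholtz equation, [a2 + i b2] the modified one; only
    their sum is assumed to be radiating. *)
Section RadiatingDecay.
Context {R : realType}.
Variables (R0 k : R).
Hypotheses (R0_ge0 : 0 <= R0) (k_gt0 : 0 < k).
Variables (a1 b1 : wave R0 (- (k * k))) (a2 b2 : wave R0 (k * k)).

(** Squared modulus of the radiation defect [u_r - i k u] of the sum. *)
Let rho r t := (w_r a1 r t + w_r a2 r t + k * (b1 r t + b2 r t)) ^+ 2 +
    (w_r b1 r t + w_r b2 r t - k * (a1 r t + a2 r t)) ^+ 2.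

Hypothesis sommerfeld : forall e : R, 0 < e -> \forall r \near +oo, forall t,
  r * rho r t <= e.
Hypothesis evanescent : forall e : R, 0 < e -> \forall r \near +oo, forall t,
  r * (a2 r t ^+ 2 + b2 r t ^+ 2) <= e.

(** The Helmholtz part is small at the radii provided by [good_radius]. *)
Lemma decay_good_radius (e : R) : 0 < e -> \forall r \near +oo,
  exists2 x, r - 3 < x < r & a1 x 0 ^+ 2 + b1 x 0 ^+ 2 <= e.
Proof.
move=> e0.
have kk : 0 < k * k by rewrite mulr_gt0.
pose w0 := (R0 + 1) * wV a1 b1 (R0 + 1).
pose E := 1 + 2 * k * `|w0|.
have E1 : 1 <= E by rewrite /E lerDl !mulr_ge0// ltW.
have E0 : 0 < E by lra.
pose K := `|wH a1 b1 (R0 + 1)| + E + E / (k * k).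
(* m is the weight in sup_bound, s the tolerated radiation defect *)
have [m m0 mE] : exists2 m, 0 < m & m * (E / (k * k)) = e / 4.
  exists (e * (k * k) / (4 * E)); last by field; rewrite !gt_eqF.
  by apply: divr_gt0; apply: mulr_gt0.
have [s s0 [s1 s2]] : exists2 s, 0 < s & s <= 1 /\ s <= e * m / 4.
  exists (Num.min 1 (e * m / 4)).
    by rewrite lt_min ltr01 divr_gt0// mulr_gt0.
  by rewrite !ge_min !lexx orbT.
have s8 : 0 < s / 8 by lra.
have sp : 0 < s / (8 * pi) by rewrite divr_gt0 ?mulr_gt0 ?pi_gt0.
have [B1 [_ HB1]] := sommerfeld sp.
have G := good_radius R0_ge0 k_gt0 evanescent s8.
near=> r.
have r1 : R0 + 1 + 3 < r by near: r; exact/nbhs_pinfty_gt/num_real.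
have r2 : B1 + 3 < r by near: r; exact/nbhs_pinfty_gt/num_real.
have r3 : 4 * E / (k * k * e) + 3 < r by near: r; exact/nbhs_pinfty_gt/num_real.
have r4 : 4 * K / (m * e) + 3 < r by near: r; exact/nbhs_pinfty_gt/num_real.
have [x hx gx] : exists2 x, r - 3 < x < r &
  x * (wP a2 x + wP b2 x + k * k * (wN a2 x + wN b2 x)) <= s / 8 by near: r.
exists x => //.
have R00 := R0_ge0.
have /andP[hx1 _] := hx.
have low c : c + 3 < r -> c < x.
  by move=> h; apply: lt_trans hx1; rewrite ltrBrDr.
have R1 : R0 < R0 + 1 by rewrite ltrDl.
have R1x := ltW (low _ r1). have Rx := lt_le_trans R1 R1x.
have x1 : 1 < x by apply: le_lt_trans (low _ r1); rewrite lerDr.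
have x0 := le_lt_trans R00 Rx.
have xn0 : x != 0 by rewrite gt_eqF.
pose N := wN a1 x + wN b1 x; pose P := wP a1 x + wP b1 x.
pose Q := wQ a1 x + wQ b1 x; pose T := wT a1 x + wT b1 x.
pose S := x * (P + k * k * N - 2 * k * wV a1 b1 x).
have N0 : 0 <= N by rewrite addr_ge0// ip_ge0.
have P0 : 0 <= P by rewrite addr_ge0// ip_ge0.
have Ss : S <= s.
  have := cross_bound R0_ge0 Rx (HB1 x (low _ r2)).
  rewrite -/N -/P -/S => /le_trans; apply.
  have -> : 4 * pi * (s / (8 * pi)) = s / 2.
    have pe (p : R) : p != 0 -> 4 * p * (s / (8 * p)) = s / 2 by move=> p0; field.
    by rewrite pe// lt0r_neq0// pi_gt0.
  by lra.
have w0E : x * wV a1 b1 x = w0 by exact: wV_const.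
have EE : S + 2 * k * w0 <= E.
  have : 2 * k * w0 <= 2 * k * `|w0| by rewrite ler_pM2l ?mulr_gt0// ler_norm.
  by rewrite /E; move: (2 * k * w0) => v h; apply: lerD; first exact: le_trans Ss s1.
have PN : x * P + k * k * (x * N) = S + 2 * k * w0 by rewrite -w0E /S; ring.
have QPN : Q <= (P + N) / 2.
  have := lerD (wQ_le a1 Rx) (wQ_le b1 Rx).
  by rewrite -mulrDl addrACA.
have Hx : wH a1 b1 x <= `|wH a1 b1 (R0 + 1)|.
  have W := wH_noninc R00 a1 b1 R1 R1x.
  exact: le_trans W (ler_norm _).
have TE : T / x = wH a1 b1 x / (x * x) + S + Q + N / (2 * x).
  by rewrite /wH -/P -/Q -/N -/T /S; field.
have [xN Tx] := angular_bound kk x1 N0 P0 QPN PN EE Hx (normr_ge0 _) TE.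
have {}Tx : T / x <= s + K / x by apply: (le_trans Tx); rewrite lerD2r.
have Ta : a1 x 0 ^+ 2 + b1 x 0 ^+ 2 <= N + m * (x * N) + T / (x * m).
  have := lerD (sup_bound R00 a1 Rx m0) (sup_bound R00 b1 Rx m0).
  congr (_ <= _); rewrite /N /T; ring.
apply: (le_trans Ta).
exact: balance_bound e0 kk m0 x0 E0 mE s2 (low _ r3) (low _ r4) xN Tx.
Unshelve. all: by end_near. Qed.

Theorem wave_decay (e : R) : 0 < e -> \forall r \near +oo,
  a1 r 0 ^+ 2 + b1 r 0 ^+ 2 <= e.
Proof.
move=> e0.
(* x3 bounds the growth of the field over a window of length 3 *)
have [x3 x3E] : exists x, x = expR (3 : R) by eexists.
have x30 : 0 < x3 by rewrite x3E expR_gt0.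
pose c := e / (10 * x3 + 2).
have c0 : 0 < c by rewrite /c divr_gt0 //; lra.
have ce : (10 * x3 + 2) * c = e by rewrite /c mulrC divfK// gt_eqF//; lra.
clearbody c.
have [B1 [_ HB1]] := sommerfeld c0.
have [B2 [_ HB2]] := evanescent c0.
have G := decay_good_radius c0.
pose A r := a1 r 0 + a2 r 0; pose B r := b1 r 0 + b2 r 0.
pose A' r := w_r a1 r 0 + w_r a2 r 0; pose B' r := w_r b1 r 0 + w_r b2 r 0.
pose phi r := A r * A r + B r * B r.
(* the radiation condition gives phi' <= phi + c, so psi is nonincreasing *)
pose psi r := expR (- r) * (phi r + c).
pose dpsi r := expR (- r) * (2 * (A r * A' r + B r * B' r) - phi r - c).
pose M := Num.max (R0 + 1) B1.
have MR : R0 + 1 <= M by rewrite le_max lexx.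
have MB : B1 <= M by rewrite le_max lexx orbT.
have R00 := R0_ge0.
have dps (r : R) : M < r -> is_derive r 1 psi (dpsi r).
  move=> Mr; have Rr : R0 < r by lra.
  have d1 := wd_r a1 r 0 Rr; have d2 := wd_r a2 r 0 Rr.
  have d3 := wd_r b1 r 0 Rr; have d4 := wd_r b2 r 0 Rr.
  have dE : is_derive r 1 (fun r : R => expR (- r)) (- expR (- r)).
    have := @is_derive1_comp _ expR -%R r _ _ (is_derive_expR (- r)) (is_deriveNid r 1).
    by move/der_eq; apply; rewrite mulrN1.
  by rewrite /psi /phi /A /B; eapply der_eq; [der|rewrite /dpsi /phi /A /B /A' /B'; cbn beta; ring].
have dneg (r : R) : M < r -> dpsi r <= 0.
  move=> Mr; rewrite /dpsi pmulr_rle0 ?expR_gt0//.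
  have rB : B1 < r by lra.
  have h := HB1 r rB 0.
  have r1 : 1 < r by lra.
  have q0 : 0 <= rho r 0 by rewrite addr_ge0 ?sqr_ge0.
  have q1 : rho r 0 <= r * rho r 0 by rewrite ler_peMl// ltW.
  have q : rho r 0 <= c by lra.
  move: q; rewrite /rho -/(A r) -/(B r) -/(A' r) -/(B' r) /phi.
  have := sqr_ge0 (A r - (A' r + k * B r)); have := sqr_ge0 (B r - (B' r - k * A r)).
  by nra.
near=> r.
have r1 : M + 3 < r by near: r; exact/nbhs_pinfty_gt/num_real.
have r2 : B2 + 3 < r by near: r; exact/nbhs_pinfty_gt/num_real.
have [x hx gx] : exists2 x, r - 3 < x < r & a1 x 0 ^+ 2 + b1 x 0 ^+ 2 <= c by near: r.
have small y : 1 < y -> B2 < y -> a2 y 0 ^+ 2 + b2 y 0 ^+ 2 <= c.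
  move=> y1 yB; have h := HB2 y yB 0; apply: le_trans h.
  by rewrite ler_peMl ?addr_ge0 ?sqr_ge0// ltW.
have sx : a2 x 0 ^+ 2 + b2 x 0 ^+ 2 <= c by apply: small; lra.
have sr : a2 r 0 ^+ 2 + b2 r 0 ^+ 2 <= c by apply: small; lra.
have px : phi x <= 4 * c.
  move: sx gx; rewrite /phi /A /B.
  have := sqr_ge0 (a1 x 0 - a2 x 0); have := sqr_ge0 (b1 x 0 - b2 x 0).
  by nra.
have ps : psi r <= psi x by apply: (nonincreasing_of_der dps dneg); lra.
have pr : phi r + c <= x3 * (5 * c).
  have -> : phi r + c = expR r * psi r.
    by rewrite /psi mulrA -expRD subrr expR0 mul1r.
  apply: (@le_trans _ _ (expR r * psi x)); first by rewrite ler_pM2l ?expR_gt0.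
  rewrite /psi mulrA -expRD.
  have cx : phi x + c <= 5 * c by lra.
  have p0 : 0 <= phi x + c by rewrite addr_ge0 ?(ltW c0)// /phi -!expr2 addr_ge0 ?sqr_ge0.
  apply: ler_pM; rewrite ?expR_ge0//.
  by rewrite x3E ler_expR; lra.
apply: (@le_trans _ _ (2 * phi r + 2 * c)); last by move: pr; rewrite -ce; lra.
move: sr; rewrite /phi /A /B.
have := sqr_ge0 (a1 r 0 + 2 * a2 r 0); have := sqr_ge0 (b1 r 0 + 2 * b2 r 0).
by nra.
Unshelve. all: by end_near. Qed.

End RadiatingDecay.

(** * Passage to polar coordinates *)

(** Partial derivatives in the two coordinates. *)
Definition D0 {R : realType} (f : 'rV[R]_2 -> R) (x : 'rV[R]_2) : R :=
  derive f x (delta_mx ord0 (ord0 : 'I_2)).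
Definition D1 {R : realType} (f : 'rV[R]_2 -> R) (x : 'rV[R]_2) : R :=
  derive f x (delta_mx ord0 (lift ord0 ord0 : 'I_2)).

(** The Laplacian of a real function. It is sealed to keep unification from
    unfolding iterated derivatives. *)
HB.lock Definition lap {R : realType} (f : 'rV[R]_2 -> R) (x : 'rV[R]_2) : R :=
  D0 (D0 f) x + D1 (D1 f) x.

Section Polar.
Context {R : realType}.
Local Notation plane := 'rV[R]_2.
Implicit Types (f : plane -> R).

Local Notation i0 := (ord0 : 'I_2).
Local Notation i1 := (lift ord0 ord0 : 'I_2).
Local Notation E0 := (delta_mx ord0 i0 : plane).
Local Notation E1 := (delta_mx ord0 i1 : plane).

Lemma dot2 (x y : plane) : dot x y = x ord0 i0 * y ord0 i0 + x ord0 i1 * y ord0 i1.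
Proof. by rewrite /dot !big_ord_recl big_ord0 addr0. Qed.

Lemma dot_enorm1 (x : plane) : enorm x = 1 -> dot x x = 1.
Proof.
move=> x1; rewrite -[LHS]sqr_sqrtr -?/(enorm x) ?x1 ?expr1n// dot2.
by rewrite addr_ge0// -expr2 sqr_ge0.
Qed.

Lemma row2E (v : plane) : v = v ord0 i0 *: E0 + v ord0 i1 *: E1.
Proof.
apply/rowP => j; rewrite !mxE !eqxx /=.
by case: (unliftP ord0 j) => [k ->|->]; rewrite ?ord1 !(mulr1, mulr0, addr0, add0r).
Qed.

Lemma derive_row2 f (x v : plane) : differentiable f x ->
  derive f x v = v ord0 i0 * D0 f x + v ord0 i1 * D1 f x.
Proof.
move=> df; rewrite /D0 /D1 !deriveE// [in LHS](row2E v) linearD !linearZ.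
by [].
Qed.

(** Chain rule along a curve in the plane. *)
Lemma chain2 f (c : R -> plane) (v : plane) (t : R) : differentiable f (c t) ->
  (forall j, is_derive t 1 (fun t => c t ord0 j) (v ord0 j)) ->
  is_derive t 1 (fun t => f (c t)) (v ord0 i0 * D0 f (c t) + v ord0 i1 * D1 f (c t)).
Proof.
move=> df dc.
have dv : derivable c t 1.
  by apply/derivable_mxP => i j; rewrite ord1; have [] := dc j.
have ve : 'D_1 c t = v.
  by rewrite derive_mx//; apply/rowP => j; rewrite mxE; have [_ ->] := dc j.
have dd : differentiable c t by apply/derivable1_diffP.
have dfc : differentiable (f \o c) t by exact: differentiable_comp.
apply: DeriveDef; first exact: diff_derivable.
rewrite -derive_row2// [LHS]deriveE// [RHS]deriveE// diff_comp//=.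
by rewrite -ve deriveE.
Qed.

Section Build.
Variables (f : plane -> R) (R0 kap : R) (xh : plane).
Hypotheses (R0_ge0 : 0 <= R0) (xh1 : enorm xh = 1).
Let U : set plane := [set x | R0 < enorm x].
Hypothesis fC2 : class_C 2 U f.
Hypothesis feq : forall x, U x -> lap f x = kap * f x.

(** The unit vector at angle [t], angles being counted from [xh]. *)
Definition dirC t : R := cos t * xh ord0 i0 - sin t * xh ord0 i1.
Definition dirS t : R := cos t * xh ord0 i1 + sin t * xh ord0 i0.
Definition dir (t : R) : plane := dirC t *: E0 + dirS t *: E1.

Lemma dir_i0 t : dir t ord0 i0 = dirC t.
Proof. by rewrite !mxE !eqxx/= mulr1 mulr0 addr0. Qed.
Lemma dir_i1 t : dir t ord0 i1 = dirS t.
Proof. by rewrite !mxE !eqxx/= mulr1 mulr0 add0r. Qed.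

Lemma dir0 : dir 0 = xh.
Proof. by rewrite [RHS]row2E /dir /dirC /dirS cos0 sin0 !mul1r !mul0r subr0 addr0. Qed.

Lemma dirCS t : dirC t * dirC t + dirS t * dirS t = 1.
Proof.
have h := dot_enorm1 xh1.
have := cos2Dsin2 t; rewrite dot2 in h.
rewrite /dirC /dirS => cs.
transitivity ((cos t ^+ 2 + sin t ^+ 2) * (xh ord0 i0 * xh ord0 i0 + xh ord0 i1 * xh ord0 i1)); first by ring.
by rewrite h cs mul1r.
Qed.

Lemma enorm_dir r t : 0 <= r -> enorm (r *: dir t) = r.
Proof.
have rZ j : (r *: dir t) ord0 j = r * dir t ord0 j by rewrite mxE.
move=> r0; rewrite /enorm dot2 !rZ dir_i0 dir_i1.
rewrite (_ : _ + _ = r ^+ 2 * (dirC t * dirC t + dirS t * dirS t)); last by ring.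
by rewrite dirCS mulr1 sqrtr_sqr ger0_norm.
Qed.

Lemma der_dirC (t : R) : is_derive t 1 dirC (- dirS t).
Proof.
have d1 := is_derive_cos t; have d2 := is_derive_sin t.
by rewrite /dirC; eapply der_eq; [der|rewrite /dirS; cbn beta; ring].
Qed.

Lemma der_dirS (t : R) : is_derive t 1 dirS (dirC t).
Proof.
have d1 := is_derive_cos t; have d2 := is_derive_sin t.
by rewrite /dirS; eapply der_eq; [der|rewrite /dirC; cbn beta; ring].
Qed.

Lemma dir_per : dirC (2 * pi) = dirC 0 /\ dirS (2 * pi) = dirS 0.
Proof.
by rewrite /dirC /dirS [2 * pi]mulr_natl cos2pi sin2pi cos0 sin0.
Qed.

Lemma pt_in r t : R0 < r -> U (r *: dir t).
Proof. by move=> Rr; rewrite /U/= enorm_dir// ltW// (le_lt_trans R0_ge0). Qed.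

Lemma der_pt_r (g : plane -> R) (r t : R) : R0 < r -> (forall x, U x -> differentiable g x) ->
  is_derive r 1 (fun r => g (r *: dir t))
    (dirC t * D0 g (r *: dir t) + dirS t * D1 g (r *: dir t)).
Proof.
move=> Rr dg; rewrite -dir_i0 -dir_i1.
apply: (@chain2 g (fun r => r *: dir t)); first exact/dg/pt_in.
move=> j; rewrite (_ : (fun _ => _) = (fun r => r * dir t ord0 j)); last first.
  by apply/funext => x; rewrite mxE.
by eapply der_eq; [der|rewrite mul1r mulr0 addr0].
Qed.

Lemma der_pt_t (g : plane -> R) (r t : R) : R0 < r -> (forall x, U x -> differentiable g x) ->
  is_derive t 1 (fun t => g (r *: dir t))
    (r * (- dirS t * D0 g (r *: dir t) + dirC t * D1 g (r *: dir t))).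
Proof.
move=> Rr dg; pose v : plane := r *: (- dirS t *: E0 + dirC t *: E1).
have v0 : v ord0 i0 = r * - dirS t by rewrite !mxE !eqxx/= mulr1 mulr0 addr0.
have v1 : v ord0 i1 = r * dirC t by rewrite !mxE !eqxx/= mulr1 mulr0 add0r.
rewrite mulrDr !mulrA -v0 -v1.
apply: (@chain2 g (fun t => r *: dir t)); first exact/dg/pt_in.
have d1 := der_dirC t; have d2 := der_dirS t.
move=> j; case: (unliftP ord0 j) => [k ->|->]; rewrite ?ord1.
- rewrite v1 (_ : (fun _ => _) = (fun t => r * dirS t)); last first.
    by apply/funext => x; rewrite mxE dir_i1.
  by eapply der_eq; [der|rewrite mul0r add0r].
- rewrite v0 (_ : (fun _ => _) = (fun t => r * dirC t)); last first.
    by apply/funext => x; rewrite mxE dir_i0.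
  by eapply der_eq; [der|rewrite mul0r add0r].
Qed.

Lemma cont_dirC : continuous dirC.
Proof. exact: is_derive_continuous der_dirC. Qed.
Lemma cont_dirS : continuous dirS.
Proof. exact: is_derive_continuous der_dirS. Qed.

Lemma jcont_pt (g : plane -> R) : (forall x, U x -> {for x, continuous g}) ->
  jcont R0 (fun r t => g (r *: dir t)).
Proof.
move=> cg r t Rr.
apply: (@continuous_comp _ _ _ (fun p : R * R => p.1 *: dir p.2) g); last exact/cg/pt_in.
apply: cvgZ; first exact: cvg_fst.
rewrite /dir; apply: cvgD; apply: cvgZr_tmp.
- by apply: (@continuous_comp _ _ _ snd dirC); [exact: cvg_snd|exact: cont_dirC].
- by apply: (@continuous_comp _ _ _ snd dirS); [exact: cvg_snd|exact: cont_dirS].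
Qed.

(** A function of class [C^2] with [Delta f = kap f] outside a disc is a wave in
    polar coordinates. *)
Lemma wave_of_C2 : exists w : wave R0 kap,
  (forall r t, w r t = f (r *: dir t)) /\
  (forall r t, R0 < r -> w_r w r t = derive f (r *: dir t) (dir t)).
Proof.
have [df dd] := fC2.
have d0 : forall x, U x -> differentiable (D0 f) x by have [] := dd E0.
have d1 : forall x, U x -> differentiable (D1 f) x by have [] := dd E1.
have c00 : forall x, U x -> {for x, continuous (D0 (D0 f))} by have [_] := dd E0; apply.
have c01 : forall x, U x -> {for x, continuous (D1 (D0 f))} by have [_] := dd E0; apply.
have c10 : forall x, U x -> {for x, continuous (D0 (D1 f))} by have [_] := dd E1; apply.
have c11 : forall x, U x -> {for x, continuous (D1 (D1 f))} by have [_] := dd E1; apply.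
have cdif g : (forall x, U x -> differentiable g x) ->
    forall x, U x -> {for x, continuous (g : plane -> R)}.
  by move=> dg x Ux; exact/differentiable_continuous/dg.
have jf := jcont_pt (cdif _ df).
have j0 := jcont_pt (cdif _ d0).
have j1 := jcont_pt (cdif _ d1).
have j00 := jcont_pt c00. have j01 := jcont_pt c01.
have j10 := jcont_pt c10. have j11 := jcont_pt c11.
have jr := @jcont_r R R0.
have jC : jcont R0 (fun _ t => dirC t) by apply: jcont_t; exact: cont_dirC.
have jS : jcont R0 (fun _ t => dirS t) by apply: jcont_t; exact: cont_dirS.
pose F r t := f (r *: dir t).
pose G0 r t := D0 f (r *: dir t). pose G1 r t := D1 f (r *: dir t).
pose H00 r t := D0 (D0 f) (r *: dir t). pose H01 r t := D1 (D0 f) (r *: dir t).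
pose H10 r t := D0 (D1 f) (r *: dir t). pose H11 r t := D1 (D1 f) (r *: dir t).
pose Fr r t := dirC t * G0 r t + dirS t * G1 r t.
pose Ft r t := r * (- dirS t * G0 r t + dirC t * G1 r t).
pose Frr r t := dirC t * (dirC t * H00 r t + dirS t * H01 r t) +
  dirS t * (dirC t * H10 r t + dirS t * H11 r t).
pose Ftr r t := (- dirS t * G0 r t + dirC t * G1 r t) +
  r * (- dirS t * (dirC t * H00 r t + dirS t * H01 r t) +
  dirC t * (dirC t * H10 r t + dirS t * H11 r t)).
pose Frt r t := (- dirS t * G0 r t + dirC t * G1 r t) +
  (dirC t * (r * (- dirS t * H00 r t + dirC t * H01 r t)) +
   dirS t * (r * (- dirS t * H10 r t + dirC t * H11 r t))).
pose Ftt r t := r * (- dirC t * G0 r t - dirS t * G1 r t +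
  (- dirS t * (r * (- dirS t * H00 r t + dirC t * H01 r t)) +
   dirC t * (r * (- dirS t * H10 r t + dirC t * H11 r t)))).
have eF (r t : R) : R0 < r -> is_derive r 1 (F^~ t) (Fr r t).
  by move=> Rr; exact: der_pt_r.
have eT (r t : R) : R0 < r -> is_derive t 1 (F r) (Ft r t).
  by move=> Rr; exact: der_pt_t.
have eG0r (r t : R) : R0 < r -> is_derive r 1 (G0^~ t) (dirC t * H00 r t + dirS t * H01 r t).
  by move=> Rr; exact: der_pt_r.
have eG1r (r t : R) : R0 < r -> is_derive r 1 (G1^~ t) (dirC t * H10 r t + dirS t * H11 r t).
  by move=> Rr; exact: der_pt_r.
have eG0t (r t : R) : R0 < r -> is_derive t 1 (G0 r) (r * (- dirS t * H00 r t + dirC t * H01 r t)).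
  by move=> Rr; exact: der_pt_t.
have eG1t (r t : R) : R0 < r -> is_derive t 1 (G1 r) (r * (- dirS t * H10 r t + dirC t * H11 r t)).
  by move=> Rr; exact: der_pt_t.
have eRR (r t : R) : R0 < r -> is_derive r 1 (Fr^~ t) (Frr r t).
  move=> Rr; have k0 := eG0r r t Rr; have k1 := eG1r r t Rr.
  by rewrite /Fr; eapply der_eq; [der|rewrite /Frr; cbn beta; ring].
have eTR (r t : R) : R0 < r -> is_derive r 1 (Ft^~ t) (Ftr r t).
  move=> Rr; have k0 := eG0r r t Rr; have k1 := eG1r r t Rr.
  by rewrite /Ft; eapply der_eq; [der|rewrite /Ftr; cbn beta; ring].
have eRT (r t : R) : R0 < r -> is_derive t 1 (Fr r) (Frt r t).
  move=> Rr; have k0 := eG0t r t Rr; have k1 := eG1t r t Rr.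
  have kC := der_dirC t; have kS := der_dirS t.
  by rewrite /Fr; eapply der_eq; [der|rewrite /Frt; cbn beta; ring].
have eTT (r t : R) : R0 < r -> is_derive t 1 (Ft r) (Ftt r t).
  move=> Rr; have k0 := eG0t r t Rr; have k1 := eG1t r t Rr.
  have kC := der_dirC t; have kS := der_dirS t.
  by rewrite /Ft; eapply der_eq; [der|rewrite /Ftt; cbn beta; ring].
have nS := jcontN jS. have nC := jcontN jC.
have jFr : jcont R0 Fr := jcontD (jcontM jC j0) (jcontM jS j1).
have jA : jcont R0 (fun r t => - dirS t * G0 r t + dirC t * G1 r t) :=
  jcontD (jcontM nS j0) (jcontM jC j1).
have jFt : jcont R0 Ft := jcontM jr jA.
have jr0 : jcont R0 (fun r t => dirC t * H00 r t + dirS t * H01 r t) :=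
  jcontD (jcontM jC j00) (jcontM jS j01).
have jr1 : jcont R0 (fun r t => dirC t * H10 r t + dirS t * H11 r t) :=
  jcontD (jcontM jC j10) (jcontM jS j11).
have jt0 : jcont R0 (fun r t => r * (- dirS t * H00 r t + dirC t * H01 r t)) :=
  jcontM jr (jcontD (jcontM nS j00) (jcontM jC j01)).
have jt1 : jcont R0 (fun r t => r * (- dirS t * H10 r t + dirC t * H11 r t)) :=
  jcontM jr (jcontD (jcontM nS j10) (jcontM jC j11)).
have jFrr : jcont R0 Frr := jcontD (jcontM jC jr0) (jcontM jS jr1).
have jFtr : jcont R0 Ftr := jcontD jA (jcontM jr (jcontD (jcontM nS jr0) (jcontM jC jr1))).
have jFrt : jcont R0 Frt := jcontD jA (jcontD (jcontM jC jt0) (jcontM jS jt1)).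
have jFtt : jcont R0 Ftt :=
  jcontM jr (jcontD (jcontD (jcontM nC j0) (jcontN (jcontM jS j1)))
    (jcontD (jcontM nS jt0) (jcontM jC jt1))).
have sw r t : R0 < r -> Frt r t = Ftr r t by exact: (schwarz eF eT eRT eTR jFrt jFtr).
have eTR' (r t : R) : R0 < r -> is_derive r 1 (Ft^~ t) (Frt r t).
  by move=> Rr; apply: (der_eq (eTR r t Rr)); rewrite sw.
have [pC pS] := dir_per.
have pdir : dir (2 * pi) = dir 0 by rewrite /dir pC pS.
have pF r : R0 < r -> F r (2 * pi) = F r 0 by rewrite /F pdir.
have pFr r : R0 < r -> Fr r (2 * pi) = Fr r 0 by rewrite /Fr /G0 /G1 pdir pC pS.
have pFt r : R0 < r -> Ft r (2 * pi) = Ft r 0 by rewrite /Ft /G0 /G1 pdir pC pS.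
have eqn r t : R0 < r -> Frr r t = kap * F r t - Fr r t / r - Ftt r t / (r * r).
  move=> Rr; rewrite /F -feq ?lap.unlock; last exact: pt_in.
  rewrite -/(H00 r t) -/(H11 r t).
  have r0 : r != 0 by rewrite gt_eqF// (le_lt_trans R0_ge0).
  have cs := dirCS t.
  have -> : H00 r t + H11 r t =
    (dirC t * dirC t + dirS t * dirS t) * (H00 r t + H11 r t) by rewrite cs mul1r.
  by rewrite /Frr /Fr /Ftt; field.
exists (@Wave R R0 kap F Fr Ft Frr Frt Ftt eF eT eRR eRT eTR' eTT
  jf jFr jFt jFrr jFrt jFtt pF pFr pFt eqn).
split => //= r t Rr; rewrite derive_row2; last exact/df/pt_in.
by rewrite dir_i0 dir_i1.
Qed.

End Build.
End Polar.

(** * Functions of class C^m on open sets *)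

Lemma near_eq_differentiable (R : realType) (V W : normedModType R) (f g : V -> W) (x : V) :
  (\forall y \near x, f y = g y) -> differentiable f x -> differentiable g x.
Proof.
move=> fg df.
have fgx : f x = g x := nbhs_singleton fg.
have dc : continuous ('d f x) by exact: diff_continuous.
have E : g \o shift x = cst (g x) + 'd f x +o_ (0 : V) id.
  apply/eqaddoP => e e0.
  have /eqaddoP/(_ e e0) := diff_locally df.
  have fgs : \forall h \near (0 : V), f (h + x) = g (h + x).
    have h0 : (h + x) @[h --> (0 : V)] --> x.
      rewrite -[X in _ --> X]add0r; apply: cvgD; [exact: cvg_id|exact: cvg_cst].
    exact: h0 fg.
  apply: filterS2 fgs => h e1.
  by rewrite !fctE/= e1 fgx.
by apply/diff_locallyP; rewrite (diff_unique dc E).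
Qed.

Section ClassC.
Context {R : realType}.
Local Notation plane := 'rV[R]_2.
Implicit Types (f g : plane -> R) (U V : set plane) (m : nat).

Lemma open_near U f g x : open U -> (forall y, U y -> f y = g y) -> U x ->
  \forall y \near x, f y = g y.
Proof.
by move=> oU fg Ux; apply: filterS (open_nbhs_nbhs (conj oU Ux)) => y; exact: fg.
Qed.

Lemma class_C_eq m U f g : open U -> (forall x, U x -> f x = g x) ->
  class_C m U f -> class_C m U g.
Proof.
move=> oU; elim: m f g => [|m IH] f g fg /=.
  move=> cf x Ux; rewrite /prop_for /continuous_at -(fg x Ux).
  have fgx : {near x, f =1 g} by exact: open_near oU fg Ux.
  exact: cvg_trans (near_eq_cvg fgx) (cf x Ux).
case=> df Df; split.
  move=> x Ux; apply: near_eq_differentiable (df x Ux).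
  exact: (open_near oU fg Ux).
move=> v; apply: IH (Df v) => x Ux.
by apply: near_eq_derive; exact: (open_near oU fg Ux).
Qed.

Lemma class_C_sub m U V f : V `<=` U -> class_C m U f -> class_C m V f.
Proof.
move=> VU; elim: m f => [|m IH] f /=; first by move=> cf x /VU; exact: cf.
by case=> df Df; split => [x /VU|v]; [exact: df|exact: IH (Df v)].
Qed.

Lemma class_CD m U f g : open U -> class_C m U f -> class_C m U g ->
  class_C m U (fun x => f x + g x).
Proof.
move=> oU; elim: m f g => [|m IH] f g /=.
  by move=> cf cg x Ux; apply: continuousD; [exact: cf|exact: cg].
move=> [df Df] [dg Dg]; split.
  by move=> x Ux; apply: differentiableD; [exact: df|exact: dg].
move=> v; apply: class_C_eq (IH _ _ (Df v) (Dg v)) => // x Ux.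
by rewrite deriveD//; apply: diff_derivable; [exact: df|exact: dg].
Qed.

Lemma class_CZ m U (c : R) f : open U -> class_C m U f ->
  class_C m U (fun x => c * f x).
Proof.
move=> oU; elim: m f => [|m IH] f /=.
  by move=> cf x Ux; apply: continuousM; [exact: cst_continuous|exact: cf].
move=> [df Df]; split.
  by move=> x Ux; apply: (@differentiableM _ _ (cst c) f); [exact: differentiable_cst|exact: df].
move=> v; apply: class_C_eq (IH _ (Df v)) => // x Ux.
by rewrite (@deriveZ _ _ _ f)//; apply: diff_derivable; exact: df.
Qed.

Lemma class_CW m U f : class_C m.+1 U f -> class_C m U f.
Proof.
elim: m f => [|m IH] f; first by case=> df _ x Ux; exact/differentiable_continuous/df.
by case=> df Df; split => // v; exact/IH/Df.
Qed.

End ClassC.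

(** * The Laplacian and plane waves *)

Section Fields.
Context {R : realType}.
Local Notation plane := 'rV[R]_2.
Local Notation i0 := (ord0 : 'I_2).
Local Notation i1 := (lift ord0 ord0 : 'I_2).
Implicit Types (f g : plane -> R) (U : set plane).

Lemma class_C_lap m U f : open U -> class_C m.+2 U f -> class_C m U (lap f).
Proof.
move=> oU [_ Df]; rewrite lap.unlock; apply: class_CD => //.
  by have [_] := Df (delta_mx ord0 i0); exact.
by have [_] := Df (delta_mx ord0 i1); exact.
Qed.

Lemma derive_lin U f g (c1 c2 : R) (v x : plane) : class_C 1 U f -> class_C 1 U g -> U x ->
  derive (fun y => c1 * f y + c2 * g y) x v = c1 * derive f x v + c2 * derive g x v.
Proof.
move=> [df _] [dg _] Ux.
have kf : derivable f x v by apply/diff_derivable/df.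
have kg : derivable g x v by apply/diff_derivable/dg.
rewrite (@deriveD _ _ _ (fun y => c1 * f y) (fun y => c2 * g y)).
- by rewrite (@deriveZ _ _ _ f)// (@deriveZ _ _ _ g).
- exact: (@derivableZ _ _ _ f).
- exact: (@derivableZ _ _ _ g).
Qed.

Lemma lap_lin U f g (c1 c2 : R) x : open U -> class_C 2 U f -> class_C 2 U g -> U x ->
  lap (fun y => c1 * f y + c2 * g y) x = c1 * lap f x + c2 * lap g x.
Proof.
move=> oU cf cg Ux.
have d2 v : derive (fun y => derive (fun z => c1 * f z + c2 * g z) y v) x v =
    c1 * derive (fun y => derive f y v) x v + c2 * derive (fun y => derive g y v) x v.
  rewrite (@near_eq_derive _ _ _ _ (fun y => c1 * derive f y v + c2 * derive g y v)); last first.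
    apply: (open_near oU _ Ux) => y Uy; apply: (@derive_lin U) => //; exact: class_CW.
  by apply: (@derive_lin U) => //; [exact: (cf.2 v)|exact: (cg.2 v)].
rewrite lap.unlock !mulrDr addrACA; exact: congr2 (d2 _) (d2 _).
Qed.

Lemma lap_eq U f g x : open U -> (forall x, U x -> f x = g x) -> U x -> lap f x = lap g x.
Proof.
move=> oU fg Ux.
have d1 v y : U y -> derive f y v = derive g y v.
  by move=> Uy; apply: near_eq_derive; exact: (open_near oU fg Uy).
have d2 v : derive (fun y => derive f y v) x v = derive (fun y => derive g y v) x v.
  by apply: near_eq_derive; apply: (open_near oU _ Ux) => y; exact: d1.
rewrite lap.unlock; exact: congr2 (d2 _) (d2 _).
Qed.

Section PlaneWave.
Variables (k : R) (d : plane).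

(** Real combinations of the real and imaginary parts of the incident wave, a
    family stable under differentiation. *)
Definition pw (a b : R) (x : plane) : R := a * cos (k * dot x d) + b * sin (k * dot x d).

Lemma is_derive_coord (j : 'I_2) (x v : plane) :
  is_derive x v (fun y : plane => y ord0 j) (v ord0 j).
Proof.
have dj : derivable (fun y : plane => y ord0 j) x v.
  by apply: diff_derivable; exact: differentiable_coord.
apply: DeriveDef => //.
have := @derive_id _ plane x v; rewrite derive_mx; last exact: derivable_id.
by move/rowP/(_ j); rewrite mxE.
Qed.

Lemma differentiable_phase (y : plane) : differentiable (fun y => k * dot y d) y.
Proof.
rewrite (_ : (fun _ => _) = (cst k) * ((fun y : plane => y ord0 i0) * cst (d ord0 i0)
    + (fun y : plane => y ord0 i1) * cst (d ord0 i1))); last first.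
  by apply/funext => z; rewrite dot2.
have c0 := @differentiable_coord R 1 2 y ord0 i0.
have c1 := @differentiable_coord R 1 2 y ord0 i1.
exact: differentiableM (differentiable_cst k y) (differentiableD
  (differentiableM c0 (differentiable_cst (d ord0 i0) y))
  (differentiableM c1 (differentiable_cst (d ord0 i1) y))).
Qed.

Lemma differentiable_pw a b x : differentiable (pw a b) x.
Proof.
have dL := differentiable_phase x.
have dc : differentiable (cos \o (fun y => k * dot y d)) x.
  by apply: differentiable_comp => //; apply/derivable1_diffP; exact: derivable_cos.
have ds : differentiable (sin \o (fun y => k * dot y d)) x.
  by apply: differentiable_comp => //; apply/derivable1_diffP; exact: derivable_sin.
exact: differentiableD (differentiableM (differentiable_cst a x) dc)
  (differentiableM (differentiable_cst b x) ds).
Qed.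

Lemma is_derive_pw (a b : R) (x v : plane) :
  is_derive x v (pw a b) (pw (k * dot v d * b) (- (k * dot v d * a)) x).
Proof.
pose L (y : plane) := k * dot y d.
have dL : forall y, differentiable L y by exact: differentiable_phase.
have LE : 'D_v L x = k * dot v d.
  rewrite (_ : L = k *: ((d ord0 i0 *: fun y : plane => y ord0 i0)
      + (d ord0 i1 *: fun y : plane => y ord0 i1))); last first.
    by apply/funext => z; rewrite /L dot2 !fctE /GRing.scale/=; ring.
  have c0 := is_derive_coord i0 x v; have c1 := is_derive_coord i1 x v.
  have := @is_deriveZ _ _ _ _ k _ _ _ (@is_deriveD _ _ _ _ _ _ _ _ _
    (@is_deriveZ _ _ _ _ (d ord0 i0) _ _ _ c0) (@is_deriveZ _ _ _ _ (d ord0 i1) _ _ _ c1)).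
  case=> _ ->; rewrite dot2 /GRing.scale/=.
  by rewrite [d ord0 i0 * _]mulrC [d ord0 i1 * _]mulrC.
have comp (h h' : R -> R) : (forall t : R, is_derive t 1 h (h' t)) ->
    is_derive x v (h \o L) (h' (L x) * (k * dot v d)).
  move=> dh.
  have hd : differentiable h (L x) by apply/derivable1_diffP; have [] := dh (L x).
  have hL : differentiable (h \o L) x by exact: differentiable_comp.
  apply: DeriveDef; first exact: diff_derivable.
  rewrite deriveE// diff_comp//= -[X in 'd h _ X]deriveE// LE.
  rewrite -[k * dot v d in LHS]mulr1 -[_ * 1]/((k * dot v d) *: (1 : R)) linearZ/= -deriveE//.
  by have [_ ->] := dh (L x); rewrite /GRing.scale/= mulrC.
have dc := comp _ _ (@is_derive_cos R).
have ds := comp _ _ (@is_derive_sin R).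
have := @is_deriveD _ _ _ (a *: (cos \o L)) (b *: (sin \o L)) x v _ _
  (@is_deriveZ _ _ _ _ a _ _ _ dc) (@is_deriveZ _ _ _ _ b _ _ _ ds).
move=> h; rewrite (_ : pw a b = a *: (cos \o L) + b *: (sin \o L))//.
apply: is_derive_eq h _.
by rewrite /pw /GRing.scale/= -/(L x); ring.
Qed.

Lemma derive_pwE (a b : R) (v x : plane) :
  derive (pw a b) x v = pw (k * dot v d * b) (- (k * dot v d * a)) x.
Proof. by have [_ ->] := is_derive_pw a b x v. Qed.

Lemma derive_pw (a b : R) (v : plane) :
  (fun x => derive (pw a b) x v) = pw (k * dot v d * b) (- (k * dot v d * a)).
Proof. by apply/funext => x; exact: derive_pwE. Qed.

Lemma class_C_pw m U a b : class_C m U (pw a b).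
Proof.
elim: m a b => [|m IH] a b /=.
  by move=> x _; exact/differentiable_continuous/differentiable_pw.
split; first by move=> x _; exact: differentiable_pw.
by move=> v; rewrite derive_pw; exact: IH.
Qed.

Lemma dot_delta (j : 'I_2) (x : plane) : dot (delta_mx ord0 j) x = x ord0 j.
Proof.
by rewrite dot2 !mxE eqxx; case: (unliftP ord0 j) => [l ->|->];
  rewrite ?ord1/= ?eqxx ?mul1r ?mul0r ?addr0 ?add0r.
Qed.

Lemma lap_pw a b : enorm d = 1 -> lap (pw a b) = fun x => - (k * k) * pw a b x.
Proof.
move=> d1; have dd := dot_enorm1 d1.
rewrite dot2 in dd.
apply/funext => x; rewrite lap.unlock /D0 /D1 !derive_pw !derive_pwE !dot_delta /pw.
set p := d ord0 i0 in dd *; set q := d ord0 i1 in dd *.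
transitivity (- (k * k) * (p * p + q * q) * (a * cos (k * dot x d) + b * sin (k * dot x d))).
  by ring.
by rewrite dd mulr1.
Qed.

End PlaneWave.
End Fields.

(** * Splitting of the scattered field *)

Section Scatter.
Context {R : realType}.
Local Notation plane := 'rV[R]_2.
Local Notation i0 := (ord0 : 'I_2).
Local Notation i1 := (lift ord0 ord0 : 'I_2).

Lemma normc_sq (z : R[i]) : normc z ^+ 2 = complex.Re z ^+ 2 + complex.Im z ^+ 2.
Proof. by case: z => x y; rewrite /= sqr_sqrtr// addr_ge0// sqr_ge0. Qed.

Lemma normc_ge0 (z : R[i]) : 0 <= normc z.
Proof. by case: z => x y; exact: sqrtr_ge0. Qed.

Lemma enorm_le (x : plane) : enorm x <= 2 * `|x|.
Proof.
have c j : `|x ord0 j| <= `|x|.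
  rewrite [leRHS]mx_normrE.
  exact: (le_bigmax_cond _ (fun ij : 'I_1 * 'I_2 => `|x ij.1 ij.2|) (j := (ord0, j))).
have n0 : 0 <= `|x| by [].
rewrite /enorm -[leRHS]ger0_norm ?mulr_ge0// -sqrtr_sqr ler_sqrt ?sqr_ge0// dot2.
have c0 := c i0; have c1 := c i1.
have s0 : x ord0 i0 * x ord0 i0 = `|x ord0 i0| ^+ 2 by rewrite real_normK ?num_real// expr2.
have s1 : x ord0 i1 * x ord0 i1 = `|x ord0 i1| ^+ 2 by rewrite real_normK ?num_real// expr2.
rewrite s0 s1.
have p0 := normr_ge0 (x ord0 i0); have p1 := normr_ge0 (x ord0 i1).
nra.
Qed.

(** The exterior of a bounded set contains the complement of a disc. *)
Lemma exterior_disc (D : set plane) : bounded_set D -> exists2 R0 : R, 0 <= R0 &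
  forall x, R0 < enorm x -> exterior D x.
Proof.
move=> [M [_ HM]].
pose M1 := `|M| + 1.
have DM x : D x -> `|x| <= M1.
  by move=> Dx; apply: (HM M1) => //; rewrite /M1; have := ler_norm M; lra.
exists (2 * M1); first by rewrite mulr_ge0// addr_ge0.
move=> x xM cx.
have xM1 : M1 < `|x| by have := enorm_le x; lra.
have nx : nbhs x [set y : plane | M1 < `|y|].
  by have := @norm_continuous _ plane x; move/cvgr_gt; apply.
have [y [Dy]] := cx _ nx.
by rewrite /= ltNge DM.
Qed.

Lemma laplacianE (f : plane -> R[i]) x :
  laplacian f x = lap (fun y => complex.Re (f y)) x +i* lap (fun y => complex.Im (f y)) x.
Proof.
have sum2 (F : 'I_2 -> R[i]) : \sum_(i < 2) F i = F i0 + F i1.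
  by rewrite !big_ord_recl big_ord0 addr0.
rewrite /laplacian sum2 lap.unlock.
have add (a b c e : R) : (a +i* b) + (c +i* e) = (a + c) +i* (b + e) by [].
exact: add.
Qed.

Lemma uHE k d (u : plane -> R[i]) x (s := scattered k d u) : u_H k d u x =
  (2^-1 * complex.Re (s x) + (- (2 * k ^+ 2)^-1) * lap (fun y => complex.Re (s y)) x) +i*
  (2^-1 * complex.Im (s x) + (- (2 * k ^+ 2)^-1) * lap (fun y => complex.Im (s y)) x).
Proof.
rewrite /u_H -/s laplacianE.
have -> : (2^-1 : R[i]) = (2^-1)%:C by rewrite fmorphV rmorph_nat.
have -> : ((k ^+ 2)%:C : R[i])^-1 = ((k ^+ 2)^-1)%:C by rewrite fmorphV.
move: (lap _ x) (lap _ x) (s x) => L1 L2 [p0 q0].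
have E (c c' p q a b : R) : c%:C * (p +i* q - (a +i* b) * c'%:C) =
    (c * p - c * c' * a) +i* (c * q - c * c' * b).
  by simpc; congr (_ +i* _); ring.
by rewrite E /= ![(2 * _)^-1]invfM ?mulNr.
Qed.

Lemma uME k d (u : plane -> R[i]) x (s := scattered k d u) : u_M k d u x =
  (2^-1 * complex.Re (s x) + (2 * k ^+ 2)^-1 * lap (fun y => complex.Re (s y)) x) +i*
  (2^-1 * complex.Im (s x) + (2 * k ^+ 2)^-1 * lap (fun y => complex.Im (s y)) x).
Proof.
rewrite /u_M -/s laplacianE.
have -> : (2^-1 : R[i]) = (2^-1)%:C by rewrite fmorphV rmorph_nat.
have -> : ((k ^+ 2)%:C : R[i])^-1 = ((k ^+ 2)^-1)%:C by rewrite fmorphV.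
move: (lap _ x) (lap _ x) (s x) => L1 L2 [p0 q0].
have E (c c' p q a b : R) : c%:C * (p +i* q + (a +i* b) * c'%:C) =
    (c * p + c * c' * a) +i* (c * q + c * c' * b).
  by simpc; congr (_ +i* _); ring.
by rewrite E /= ![(2 * _)^-1]invfM ?mulNr.
Qed.

Lemma uH_uM k d (u : plane -> R[i]) x : u x = incident_plus_uH k d u x + u_M k d u x.
Proof.
rewrite /incident_plus_uH /u_H /u_M /scattered; set L := laplacian _ _ / _.
by field.
Qed.

End Scatter.

Section HelmholtzPart.
Context {R : realType}.
Local Notation plane := 'rV[R]_2.

(** If [Delta^2 f = k^4 f], then [f / 2 + c Delta f] with [c = 1 / (2 k^2)] or
    [c = - 1 / (2 k^2)] is an eigenfunction of the Laplacian, of eigenvalue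
    [2 c k^4], that is [k^2] or [- k^2]. *)
Lemma helmholtz_split (U : set plane) (k c : R) (f : plane -> R) :
  open U -> class_C 4 U f -> (forall x, U x -> lap (lap f) x = k ^+ 4 * f x) ->
  (4 * c * c) * k ^+ 4 = 1 ->
  let h := fun x => 2^-1 * f x + c * lap f x in
  class_C 2 U h /\ forall x, U x -> lap h x = (2 * c * k ^+ 4) * h x.
Proof.
move=> oU cf ff ck h.
have cl : class_C 2 U (lap f) by exact: class_C_lap.
have c2 : class_C 2 U f := class_CW (class_CW cf).
split; first exact: class_CD oU (class_CZ 2^-1 oU c2) (class_CZ c oU cl).
move=> x Ux; rewrite (lap_lin _ _ oU c2 cl Ux) (ff x Ux) /h.
move: (lap f x) (f x) => L F; have -> : 2^-1 * L = 2^-1 * L * (4 * c * c * k ^+ 4) by rewrite ck mulr1.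
by field.
Qed.

Lemma pw_scale k (d : plane) (a b c : R) : (fun x => c * pw k d a b x) = pw k d (c * a) (c * b).
Proof. by apply/funext => x; rewrite /pw; ring. Qed.

(** Adding a plane wave preserves the biharmonic equation. *)
Lemma lap_lap_scattered (U : set plane) (k : R) (d : plane) (f : plane -> R) (a b : R) :
  open U -> enorm d = 1 -> class_C 4 U f ->
  (forall x, U x -> lap (lap f) x = k ^+ 4 * f x) ->
  let s := fun x => 1 * f x + 1 * pw k d a b x in
  class_C 4 U s /\ forall x, U x -> lap (lap s) x = k ^+ 4 * s x.
Proof.
move=> oU d1 cf ff s.
have cp m := @class_C_pw R k d m U a b.
split; first exact: class_CD oU (class_CZ 1 oU cf) (class_CZ 1 oU (cp 4)).
move=> x Ux.
have c2 : class_C 2 U f := class_CW (class_CW cf).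
have cl : class_C 2 U (lap f) by exact: class_C_lap.
have lpE a' b' : lap (pw k d a' b') = pw k d (- (k * k) * a') (- (k * k) * b').
  by rewrite (lap_pw k a' b' d1) pw_scale.
have cpl : class_C 2 U (lap (pw k d a b)) by rewrite lpE; exact: class_C_pw.
have lE y : U y -> lap s y = 1 * lap f y + 1 * lap (pw k d a b) y.
  by move=> Uy; rewrite (lap_lin _ _ oU c2 (cp 2) Uy).
have e1 := lap_eq oU lE Ux.
have e2 := lap_lin 1 1 oU cl cpl Ux.
have e3 : lap (lap (pw k d a b)) x = k ^+ 4 * pw k d a b x.
  by rewrite !lpE /pw; move: (cos _) (sin _) => q1 q2; ring.
have e4 := ff x Ux.
apply: (etrans e1); apply: (etrans e2); rewrite e4 e3 /s.
by move: (f x) (pw k d a b x) => p q; ring.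
Qed.

Lemma expR_small (k C e : R) : 0 < k -> 0 < e -> \forall r \near +oo, C * expR (- (k * r)) <= e.
Proof.
move=> k0 e0.
near=> r.
have r0 : 0 < r by near: r; exact/nbhs_pinfty_gt/num_real.
have r1 : `|C| / (k * e) < r by near: r; exact/nbhs_pinfty_gt/num_real.
have kr : 0 < k * r by rewrite mulr_gt0.
have E : k * r <= expR (k * r) by have := expR_ge1Dx (k * r); lra.
rewrite expRN ler_pdivrMr ?expR_gt0//.
apply: (le_trans (ler_norm _)).
rewrite ltr_pdivrMr ?mulr_gt0// in r1.
apply: (@le_trans _ _ (e * (k * r))); last by rewrite ler_pM2l.
by move: r1; rewrite (_ : r * (k * e) = e * (k * r)); [exact: ltW|ring].
Unshelve. all: by end_near. Qed.

(** The propagating part of a radiating scattered field tends to 0 along rays. *)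
Theorem uH_decay (k : R) (D : set plane) (d xhat : plane) (u : plane -> R[i]) (C : R) :
  0 < k -> bounded_set D -> enorm d = 1 -> enorm xhat = 1 ->
  class_Cc 4 (exterior D) u ->
  (forall x, exterior D x -> laplacian (laplacian u) x - (k ^+ 4)%:C * u x = 0) ->
  radiating k (scattered k d u) ->
  (\forall r \near +oo, forall y, enorm y = 1 ->
     normc (u_M k d u (r *: y)) <= expR (- (k * r)) / Num.sqrt r * C) ->
  forall e : R, 0 < e -> \forall r \near +oo, normc (u_H k d u (r *: xhat)) ^+ 2 <= e.
Proof.
move=> k0 bD d1 x1 [cu1 cu2] bih rad uMb e e0.
have [R0 R00 HR0] := exterior_disc bD.
have oE : open (exterior D) by apply: closed_openC; exact: closed_closure.
(* ru, s1, h1, m1 are the real parts of u, u^s, u_H, u_M, and iu, s2, h2, m2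
   the imaginary parts *)
pose ru y := complex.Re (u y); pose iu y := complex.Im (u y).
have RL : (fun y => complex.Re (laplacian u y)) = lap ru by apply/funext => y; rewrite laplacianE.
have IL : (fun y => complex.Im (laplacian u y)) = lap iu by apply/funext => y; rewrite laplacianE.
have bihE x : exterior D x -> lap (lap ru) x = k ^+ 4 * ru x /\ lap (lap iu) x = k ^+ 4 * iu x.
  move=> Ex; have := bih x Ex; rewrite laplacianE RL IL => /eqP.
  rewrite subr_eq0 => /eqP.
  move: (lap (lap ru) x) (lap (lap iu) x) => L1 L2; rewrite /ru /iu.
  case: (u x) => p q.
  by rewrite /real_complex_def; simpc => -[-> ->].
pose s1 y := complex.Re (scattered k d u y); pose s2 y := complex.Im (scattered k d u y).
have s1E : s1 = fun y => 1 * ru y + 1 * pw k d (-1) 0 y.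
  apply/funext => y; rewrite /s1 /ru /scattered /incident /cis /pw.
  by case: (u y) => p q /=; ring.
have s2E : s2 = fun y => 1 * iu y + 1 * pw k d 0 (-1) y.
  apply/funext => y; rewrite /s2 /iu /scattered /incident /cis /pw.
  by case: (u y) => p q /=; ring.
have [cs1 ls1] : class_C 4 (exterior D) s1 /\
    forall x, exterior D x -> lap (lap s1) x = k ^+ 4 * s1 x.
  rewrite s1E; exact: (lap_lap_scattered (-1) 0 oE d1 cu1 (fun x Ex => (bihE x Ex).1)).
have [cs2 ls2] : class_C 4 (exterior D) s2 /\
    forall x, exterior D x -> lap (lap s2) x = k ^+ 4 * s2 x.
  rewrite s2E; exact: (lap_lap_scattered 0 (-1) oE d1 cu2 (fun x Ex => (bihE x Ex).2)).
pose cH := - (2 * k ^+ 2)^-1; pose cM := (2 * k ^+ 2)^-1.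
have kn0 : k != 0 by rewrite gt_eqF.
have cH1 : 4 * cH * cH * k ^+ 4 = 1 by rewrite /cH; field.
have cM1 : 4 * cM * cM * k ^+ 4 = 1 by rewrite /cM; field.
have cH2 : 2 * cH * k ^+ 4 = - (k * k) by rewrite /cH; field.
have cM2 : 2 * cM * k ^+ 4 = k * k by rewrite /cM; field.
pose h1 x := 2^-1 * s1 x + cH * lap s1 x; pose h2 x := 2^-1 * s2 x + cH * lap s2 x.
pose m1 x := 2^-1 * s1 x + cM * lap s1 x; pose m2 x := 2^-1 * s2 x + cM * lap s2 x.
have [ch1 eh1] := helmholtz_split oE cs1 ls1 cH1.
have [ch2 eh2] := helmholtz_split oE cs2 ls2 cH1.
have [cm1 em1] := helmholtz_split oE cs1 ls1 cM1.
have [cm2 em2] := helmholtz_split oE cs2 ls2 cM1.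
rewrite cH2 in eh1 eh2; rewrite cM2 in em1 em2.
rewrite -/h1 in ch1 eh1; rewrite -/h2 in ch2 eh2.
rewrite -/m1 in cm1 em1; rewrite -/m2 in cm2 em2.
have sub m f : class_C m (exterior D) f -> class_C m [set x | R0 < enorm x] f.
  by apply: class_C_sub => x; exact: HR0.
have [a1 [a1E a1R]] := wave_of_C2 R00 x1 (sub _ _ ch1) (fun x Ux => eh1 x (HR0 x Ux)).
have [b1 [b1E b1R]] := wave_of_C2 R00 x1 (sub _ _ ch2) (fun x Ux => eh2 x (HR0 x Ux)).
have [a2 [a2E a2R]] := wave_of_C2 R00 x1 (sub _ _ cm1) (fun x Ux => em1 x (HR0 x Ux)).
have [b2 [b2E b2R]] := wave_of_C2 R00 x1 (sub _ _ cm2) (fun x Ux => em2 x (HR0 x Ux)).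
have sum1 x : h1 x + m1 x = s1 x by rewrite /h1 /m1 /cH /cM; move: (lap _ _) (s1 x) => L S; field.
have sum2 x : h2 x + m2 x = s2 x by rewrite /h2 /m2 /cH /cM; move: (lap _ _) (s2 x) => L S; field.
have dsum f g h x v : class_C 2 (exterior D) f -> class_C 2 (exterior D) g ->
    (forall x, f x + g x = h x) -> exterior D x ->
    derive f x v + derive g x v = derive h x v.
  move=> cf cg fg Ex.
  rewrite (_ : h = fun y => 1 * f y + 1 * g y); last by apply/funext => y; rewrite !mul1r fg.
  by rewrite (derive_lin _ _ _ (class_CW cf) (class_CW cg) Ex) !mul1r.
have inE r t : R0 < r -> exterior D (r *: dir xhat t).
  by move=> Rr; apply: HR0; rewrite enorm_dir// ltW// (le_lt_trans R00).
have dir1 t : enorm (dir xhat t) = 1.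
  by rewrite -[dir xhat t]scale1r enorm_dir.
have somm : forall e : R, 0 < e -> \forall r \near +oo, forall t, r *
   ((w_r a1 r t + w_r a2 r t + k * (b1 r t + b2 r t)) ^+ 2 +
    (w_r b1 r t + w_r b2 r t - k * (a1 r t + a2 r t)) ^+ 2) <= e.
  move=> e' e'0.
  have se0 : 0 < Num.sqrt e' by rewrite sqrtr_gt0.
  have [B [_ HB]] := rad _ se0.
  near=> r.
  have r0 : R0 < r by near: r; exact/nbhs_pinfty_gt/num_real.
  have rB : B < r by near: r; exact/nbhs_pinfty_gt/num_real.
  have rp : 0 <= r by rewrite ltW// (le_lt_trans R00).
  move=> t; have := HB r rB _ (dir1 t).
  rewrite a1R// b1R// a2R// b2R// a1E b1E a2E b2E.
  have Er := inE r t r0; move: (dir xhat t) Er => y; set x := r *: y => Er.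
  have e1 := dsum _ _ _ _ y ch1 cm1 sum1 Er; have e2 := dsum _ _ _ _ y ch2 cm2 sum2 Er.
  have e3 := sum1 x; have e4 := sum2 x.
  rewrite e1 e2 e3 e4.
  have -> : derc y (scattered k d u) x - (0 +i* k) * scattered k d u x =
    (derive s1 x y + k * s2 x) +i* (derive s2 x y - k * s1 x).
    rewrite /derc -/s1 -/s2.
    rewrite -[s1 x]/(complex.Re (scattered k d u x)) -[s2 x]/(complex.Im (scattered k d u x)).
    move: (derive s1 x y) (derive s2 x y) (scattered k d u x) => p q [a b].
    by simpc.
  move: (_ + _) (_ - _) => p q Hlt.
  have n0 : 0 <= normc (p +i* q) by rewrite sqrtr_ge0.
  rewrite -(normc_sq (p +i* q)) -[X in X * _](sqr_sqrtr rp) -exprMn.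
  rewrite -[leRHS](sqr_sqrtr (ltW e'0)).
  by rewrite ler_sqr ?nnegrE ?mulr_ge0 ?sqrtr_ge0// ltW.
have evan : forall e : R, 0 < e -> \forall r \near +oo, forall t,
    r * (a2 r t ^+ 2 + b2 r t ^+ 2) <= e.
  move=> e' e'0.
  have k20 : 0 < 2 * k by rewrite mulr_gt0.
  have small := expR_small (C ^+ 2) k20 e'0.
  have [B [_ HB]] := uMb.
  near=> r.
  have r0 : R0 < r by near: r; exact/nbhs_pinfty_gt/num_real.
  have rB : B < r by near: r; exact/nbhs_pinfty_gt/num_real.
  have rp : 0 < r by rewrite (le_lt_trans R00).
  move=> t; have := HB r rB _ (dir1 t).
  rewrite uME -/s1 -/s2 a2E b2E.
  set z := (X in normc X) => hz.
  have zE : normc z ^+ 2 = m1 (r *: dir xhat t) ^+ 2 + m2 (r *: dir xhat t) ^+ 2.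
    by rewrite /z normc_sq.
  have z0 : 0 <= normc z by rewrite sqrtr_ge0.
  rewrite -zE.
  have hz2 : normc z ^+ 2 <= (expR (- (k * r)) / Num.sqrt r * C) ^+ 2.
    by rewrite ler_sqr ?nnegrE// (le_trans z0).
  apply: (@le_trans _ _ (r * (expR (- (k * r)) / Num.sqrt r * C) ^+ 2)).
    by rewrite ler_pM2l.
  rewrite !exprMn exprVn sqr_sqrtr; last exact: ltW.
  rewrite expr2 -expRD (_ : - (k * r) + - (k * r) = - (2 * k * r)); last by ring.
  rewrite (_ : r * _ = C ^+ 2 * expR (- (2 * k * r))); first by near: r.
  by field; rewrite gt_eqF.
have := wave_decay R00 k0 somm evan e0.
apply: filterS => r.
by rewrite a1E b1E dir0 uHE normc_sq.
Unshelve. all: by end_near. Qed.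

End HelmholtzPart.

(** * Stability of Vandermonde systems *)

Lemma unitmx_of_ker (F : fieldType) (n : nat) (A : 'M[F]_n) :
  (forall z : 'cV[F]_n, A *m z = 0 -> z = 0) -> A \in unitmx.
Proof.
move=> h; rewrite -unitmx_tr -row_free_unit -kermx_eq0; apply/eqP/row_matrixP => i.
rewrite row0; apply: (can_inj trmxK); rewrite trmx0; apply: h.
apply: (can_inj trmxK); rewrite trmx_mul trmxK trmx0.
by rewrite -row_mul mulmx_ker row0.
Qed.

Section Vandermonde.
Context {R : realType}.

Lemma Vmx_unit (n : nat) (s : 'I_n -> R) : (forall j, s j != 0) -> injective s ->
  Vmx s \in unitmx.
Proof.
move=> s0 si.
have -> : Vmx s = (Vandermonde n (\row_j (s j)^-1))^T.
  by apply/matrixP => i j; rewrite !mxE exprVn.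
rewrite unitmx_tr unitmxE det_Vandermonde unitfE.
apply/prodf_neq0 => i _; apply/prodf_neq0 => j ij.
rewrite !mxE subr_eq0 (inj_eq invr_inj) (inj_eq si).
by rewrite eq_sym; apply: contraTneq ij => ->; rewrite ltnn.
Qed.

(** Along [s_i = sigma_i t + O(1)], a bound [e] on the right-hand side of the
    Vandermonde system bounds the unknown of index [j] by [C t^j e]. After scaling the
    columns by [t^j] the matrix tends to an invertible one. *)
Lemma Vmx_stable (n : nat) (sigma : 'I_n -> R) (s : R -> 'I_n -> R) (beta : R) :
  (forall j, 0 < sigma j) -> injective sigma ->
  (\forall t \near +oo, forall j, `|s t j - sigma j * t| <= beta) ->
  exists C : R, \forall t \near +oo, Vmx (s t) \in unitmx /\
    forall (G : 'cV[R]_n) (e : R), (forall i, `|(Vmx (s t) *m G) i ord0| <= e) ->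
      forall j, `|G j ord0| <= C * t ^+ j * e.
Proof.
move=> sp si sb.
pose Y := Vmx sigma.
have uY : Y \in unitmx by apply: Vmx_unit => // j; rewrite gt_eqF.
pose K := \sum_j \sum_i `|invmx Y j i|.
have K0 : 0 <= K by apply: sumr_ge0 => j _; apply: sumr_ge0.
pose eta := (2 * (K + 1))^-1.
have eta0 : 0 < eta by rewrite invr_gt0 mulr_gt0//; lra.
have Keta : K * eta <= 2^-1.
  rewrite /eta invfM mulrCA ler_piMr// ler_pdivrMr ?mul1r; lra.
have ratio (j : 'I_n) : (t / s t j) @[t --> +oo] --> (sigma j)^-1.
  apply/cvgrPdist_le => e e0; near=> t.
  have t0 : 0 < t by near: t; exact/nbhs_pinfty_gt/num_real.
  have sj := sp j.
  have h : `|s t j - sigma j * t| <= beta by move: (j); near: t.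
  have b0 : 0 <= beta by apply: le_trans h.
  have t1 : 2 * beta / sigma j < t by near: t; exact/nbhs_pinfty_gt/num_real.
  have t2 : 2 * beta / (sigma j * sigma j * e) < t by near: t; exact/nbhs_pinfty_gt/num_real.
  rewrite ltr_pdivrMr// in t1.
  rewrite ltr_pdivrMr ?mulr_gt0// in t2.
  have s0 : sigma j * t / 2 < s t j by move: h; rewrite ler_norml => /andP[]; lra.
  have st0 : 0 < s t j by apply: lt_trans s0; rewrite divr_gt0// mulr_gt0.
  rewrite (_ : _ - _ = (s t j - sigma j * t) / (sigma j * s t j)); last first.
    by field; rewrite !gt_eqF.
  rewrite normrM normfV [X in _ / X]gtr0_norm ?mulr_gt0// ler_pdivrMr ?mulr_gt0//.
  apply: (le_trans h); apply: (@le_trans _ _ (e * (sigma j * (sigma j * t / 2)))); first by lra.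
  by rewrite ler_pM2l// ler_pM2l// ltW.
have close (i j : 'I_n) : \forall t \near +oo, `|Y i j - t ^+ j * Vmx (s t) i j| <= eta.
  have c : (t / s t i) ^+ j @[t --> +oo] --> (sigma i)^-1 ^+ j.
    exact: (cvg_comp _ _ (ratio i) (@exprn_continuous R j _)).
  move/cvgrPdist_le : c => /(_ _ eta0); apply: filterS => t.
  by rewrite !mxE exprMn !exprVn.
have {}close : \forall t \near +oo, forall i j : 'I_n,
    `|Y i j - t ^+ j * Vmx (s t) i j| <= eta.
  by apply: filter_forall => i; apply: filter_forall => j; exact: close.
have {}sb : forall j, \forall t \near +oo, `|s t j - sigma j * t| <= beta.
  by move=> j; apply: filterS sb => t /(_ j).
exists (2 * K); near=> t.
have t0 : 0 < t by near: t; exact/nbhs_pinfty_gt/num_real.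
have tn (j : nat) : t ^+ j != 0 by rewrite expf_neq0// gt_eqF.
have cl : forall i j : 'I_n, `|Y i j - t ^+ j * Vmx (s t) i j| <= eta by near: t.
have main (G : 'cV[R]_n) (e : R) : (forall i, `|(Vmx (s t) *m G) i ord0| <= e) ->
      forall j, `|G j ord0| <= 2 * K * t ^+ j * e.
  move=> He.
  pose p : 'cV[R]_n := \col_j (G j ord0 / t ^+ j).
  pose M := \sum_j `|p j ord0|.
  have M0 : 0 <= M by apply: sumr_ge0.
  have VG i : (Vmx (s t) *m G) i ord0 = \sum_(j < n) (t ^+ j * Vmx (s t) i j) * p j ord0.
    rewrite mxE; apply: eq_bigr => j _; rewrite [p _ _]mxE.
    by field.
  have Yp i : `|(Y *m p) i ord0| <= e + eta * M.
    have -> : (Y *m p) i ord0 = (Vmx (s t) *m G) i ord0 +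
        \sum_(j < n) (Y i j - t ^+ j * Vmx (s t) i j) * p j ord0.
      rewrite VG mxE -big_split/=; apply: eq_bigr => j _.
      by rewrite -mulrDl addrC subrK.
    apply: (le_trans (ler_normD _ _)); apply: lerD => //.
    apply: (le_trans (ler_norm_sum _ _ _)); rewrite /M mulr_sumr.
    by apply: ler_sum => j _; rewrite normrM ler_wpM2r.
  have pj j : `|p j ord0| <= \sum_i `|invmx Y j i| * (e + eta * M).
    have -> : p j ord0 = (invmx Y *m (Y *m p)) j ord0 by rewrite mulKmx.
    rewrite mxE; apply: (le_trans (ler_norm_sum _ _ _)).
    by apply: ler_sum => i _; rewrite normrM ler_wpM2l.
  have ML : M <= K * (e + eta * M).
    rewrite /K mulr_suml; apply: ler_sum => j _.
    by rewrite mulr_suml; exact: pj.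
  have MK : M <= 2 * K * e.
    have : K * eta * M <= 2^-1 * M by rewrite ler_wpM2r.
    by move: ML; rewrite mulrDr mulrA; lra.
  move=> j; have -> : G j ord0 = p j ord0 * t ^+ j by rewrite mxE divfK.
  rewrite normrM [`|t ^+ j|]gtr0_norm ?exprn_gt0// mulrAC ler_pM2r ?exprn_gt0//.
  apply: le_trans MK.
  by rewrite /M (bigD1 j)//= lerDl sumr_ge0.
split; last exact: main.
apply: unitmx_of_ker => z Vz; apply/colP => j; rewrite [RHS]mxE.
apply/eqP; rewrite -normr_le0 -[leRHS](mulr0 (2 * K * t ^+ j)).
by apply: main => i; rewrite Vz mxE normr0.
Unshelve. all: by end_near. Qed.

End Vandermonde.

(** * Expansion of the phaseless data *)

Section Expansion.
Context {R : realType}.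
Local Notation plane := 'rV[R]_2.

Lemma normc_cis (theta : R) : normc (cis theta) = 1.
Proof. by rewrite /= cos2Dsin2 sqrtr1. Qed.

Lemma normc_real (x : R) : normc x%:C = `|x|.
Proof. by rewrite /= expr0n/= addr0 sqrtr_sqr. Qed.

(** [2 Re (e^(- i theta) z)]. *)
Definition rot_re (theta : R) (z : R[i]) : R :=
  2 * (complex.Re z * cos theta + complex.Im z * sin theta).

Lemma rot_re_le theta z : `|rot_re theta z| <= 4 * normc z.
Proof.
have hR : `|complex.Re z| <= normc z.
  by rewrite -[leRHS]ger0_norm ?normc_ge0// -ler_sqr ?nnegrE// !real_normK ?num_real// normc_sq lerDl sqr_ge0.
have hI : `|complex.Im z| <= normc z.
  by rewrite -[leRHS]ger0_norm ?normc_ge0// -ler_sqr ?nnegrE// !real_normK ?num_real// normc_sq lerDr sqr_ge0.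
have h1 : `|complex.Re z * cos theta| <= normc z.
  by rewrite normrM -[leRHS]mulr1 ler_pM// cos_max.
have h2 : `|complex.Im z * sin theta| <= normc z.
  by rewrite normrM -[leRHS]mulr1 ler_pM// sin_max.
rewrite /rot_re normrM ger0_norm//.
by have := ler_normD (complex.Re z * cos theta) (complex.Im z * sin theta); lra.
Qed.

Lemma rot_reD theta z1 z2 : rot_re theta (z1 + z2) = rot_re theta z1 + rot_re theta z2.
Proof. by rewrite /rot_re; case: z1 => a b; case: z2 => c e /=; ring. Qed.

Lemma rot_reN theta z : rot_re theta (- z) = - rot_re theta z.
Proof. by rewrite /rot_re; case: z => a b /=; ring. Qed.

Lemma rot_reZ theta (c : R) z : rot_re theta (c%:C * z) = c * rot_re theta z.
Proof. by rewrite /rot_re; case: z => a b /=; ring. Qed.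

Lemma rot_re_sum theta n (F : 'I_n -> R[i]) :
  rot_re theta (\sum_j F j) = \sum_j rot_re theta (F j).
Proof.
apply: big_morph; first exact: rot_reD.
by rewrite /rot_re /= !mul0r addr0 mulr0.
Qed.

(** [(|A + M|^2 - |A|^2) / |A|] for [A] of modulus [rho] and argument [theta]. *)
Lemma modulus_defect (rho theta : R) (M : R[i]) : 0 < rho ->
  (normc (rho%:C * cis theta + M) ^+ 2 - normc (rho%:C * cis theta) ^+ 2) / rho =
  rot_re theta M + normc M ^+ 2 / rho.
Proof.
move=> r0; rewrite !normc_sq /rot_re; case: M => a b /=.
by field; rewrite gt_eqF.
Qed.

Lemma expR_neg_le (k : R) n : 0 < k -> (0 < n)%N ->
  exists2 D : R, 0 <= D & forall s, 0 < s -> expR (- (k * s)) <= D / s ^+ n.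
Proof.
move=> k0 n0; exists ((n%:R / k) ^+ n); first by rewrite exprn_ge0// divr_ge0// ltW.
move=> s s0; have nn : 0 < n%:R :> R by rewrite ltr0n.
rewrite ler_pdivlMr ?exprn_gt0// expRN mulrC ler_pdivrMr ?expR_gt0//.
have -> : expR (k * s) = expR (k * s / n%:R) ^+ n.
  by rewrite -expRM_natl [n%:R * _]mulrC divfK ?gt_eqF.
rewrite -exprMn lerXn2r ?nnegrE//; [exact: ltW|by rewrite mulr_ge0 ?divr_ge0 ?expR_ge0 ?ltW|].
have h := expR_ge1Dx (k * s / n%:R).
rewrite (_ : s = n%:R / k * (k * s / n%:R)); last by field; rewrite !gt_eqF.
rewrite [X in expR X](_ : _ = k * s / n%:R); last by field; rewrite !gt_eqF.
by rewrite ler_pM2l ?divr_gt0//; lra.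
Qed.

Section W.
Variables (k : R) (d xhat : plane) (u : plane -> R[i]) (g : nat -> plane -> R[i]).
Hypotheses (k_gt0 : 0 < k) (xhat1 : enorm xhat = 1).
Hypothesis uH_to0 : forall e : R, 0 < e ->
  \forall r \near +oo, normc (u_H k d u (r *: xhat)) ^+ 2 <= e.
Hypothesis atk : atkinson_expansion k (u_M k d u) g.

Lemma enormZ (s : R) : 0 <= s -> enorm (s *: xhat) = s.
Proof.
move=> s0; rewrite /enorm (_ : dot _ _ = s ^+ 2 * dot xhat xhat); last first.
  by rewrite /dot mulr_sumr; apply: eq_bigr => i _; rewrite !mxE; ring.
by rewrite sqrtrM ?sqr_ge0// sqrtr_sqr -/(enorm xhat) xhat1 mulr1 ger0_norm.
Qed.

(** The incident field has modulus 1 and [u_H] tends to 0. *)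
Lemma total_field_lb : \forall s \near +oo, 2^-1 <= normc (incident_plus_uH k d u (s *: xhat)).
Proof.
have e0 : 0 < (2^-1 : R) ^+ 2 by rewrite exprn_gt0// invr_gt0.
apply: filterS (uH_to0 e0) => s.
rewrite ler_sqr ?nnegrE ?normc_ge0 ?invr_ge0// => h.
have := le_normcD (incident_plus_uH k d u (s *: xhat)) (- u_H k d u (s *: xhat)).
rewrite normcN /incident_plus_uH addrK normc_cis.
by move: (normc _) h (normc _) => x hx y; lra.
Qed.

(** The truncated expansion of the data [w] along the ray, with a constant that
    does not depend on the argument [theta]. *)
Lemma w_expansion n : (0 < n)%N -> exists C : R, \forall s \near +oo, forall theta,
  is_arg (incident_plus_uH k d u (s *: xhat)) theta ->
  `|w k d u (s *: xhat) - \sum_(j < n) rot_re theta (g j.+1 xhat) / s ^+ j| <= C / s ^+ n.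
Proof.
move=> n0.
have [C0 [B0 [_ HB0]]] := atk 0; have [C [B1 [_ HB1]]] := atk n.
have [D D0 hD] := expR_neg_le k_gt0 n0.
exists (4 * C + 2 * C0 ^+ 2 * D); near=> s.
have s1 : 1 < s by near: s; exact/nbhs_pinfty_gt/num_real.
have s0 : 0 < s by lra.
move=> theta [z0 zE].
have lb : 2^-1 <= normc (incident_plus_uH k d u (s *: xhat)).
  by near: s; exact: total_field_lb.
have sB0 : B0 < s by near: s; exact/nbhs_pinfty_gt/num_real.
have sB1 : B1 < s by near: s; exact/nbhs_pinfty_gt/num_real.
have h0 := HB0 s sB0 xhat xhat1; have h1 := HB1 s sB1 xhat xhat1.
rewrite big_geq// mulr0 subr0 expr0 divr1 in h0.
rewrite big_add1/= big_mkord in h1.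
rewrite /w enormZ; last exact: ltW.
rewrite (uH_uM k d u) {1}zE {2}zE.
set rho := normc _ in zE lb *.
have rho0 : 0 < rho by lra.
rewrite modulus_defect//.
set M := u_M k d u _ in h0 h1 *.
set S := \sum_(i < n) _ in h1.
have -> : \sum_(j < n) rot_re theta (g j.+1 xhat) / s ^+ j = rot_re theta S.
  rewrite /S rot_re_sum; apply: eq_bigr => j _.
  by rewrite -fmorphV mulrC -rot_reZ mulrC.
(* kap is the common factor of the expansion of u_M *)
pose kap := expR (- (k * s)) / Num.sqrt s.
have sq0 : 0 < Num.sqrt s by rewrite sqrtr_gt0.
have kap0 : 0 < kap by rewrite divr_gt0// expR_gt0.
rewrite -/kap in h0 h1 *.
have kapV : Num.sqrt s * expR (k * s) = kap^-1.
  by rewrite /kap invfM invrK expRN invrK mulrC.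
rewrite kapV.
have -> : kap^-1 * (rot_re theta M + normc M ^+ 2 / rho) - rot_re theta S =
  kap^-1 * rot_re theta (M - kap%:C * S) + kap^-1 * normc M ^+ 2 / rho.
  by rewrite rot_reD rot_reN rot_reZ; field; rewrite !gt_eqF.
apply: (le_trans (ler_normD _ _)); rewrite mulrDl; apply: lerD.
  rewrite normrM gtr0_norm ?invr_gt0// mulrC ler_pdivrMr//.
  apply: (le_trans (rot_re_le _ _)).
  by rewrite [leRHS](_ : _ = 4 * (kap * (C / s ^+ n))); [rewrite ler_pM2l|ring].
rewrite ger0_norm; last by rewrite !mulr_ge0// ?invr_ge0 ?(ltW kap0) ?(ltW rho0) ?normc_ge0// exprn_ge0// normc_ge0.
have M2 : normc M ^+ 2 <= (kap * C0) ^+ 2.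
  by rewrite ler_sqr ?nnegrE ?normc_ge0// (le_trans (normc_ge0 M)).
have r2 : rho^-1 <= 2 by rewrite -[leRHS]invrK lef_pV2 ?posrE// invr_gt0.
apply: (@le_trans _ _ (kap^-1 * (kap * C0) ^+ 2 * 2)).
  apply: ler_pM => //.
  - by rewrite mulr_ge0 ?invr_ge0 ?(ltW kap0)// exprn_ge0// normc_ge0.
  - by rewrite invr_ge0 ltW.
  - by rewrite ler_pM2l ?invr_gt0.
rewrite [leLHS](_ : _ = 2 * C0 ^+ 2 * kap); last by field; rewrite gt_eqF.
have C2 : 0 <= 2 * C0 ^+ 2 by rewrite mulr_ge0// sqr_ge0.
rewrite -[leRHS]mulrA; apply: (ler_wpM2l C2).
apply: le_trans (hD s s0); rewrite /kap ler_pdivrMr// ler_peMr ?expR_ge0//.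
by rewrite -[leLHS]sqrtr1 ler_sqrt ltW.
Unshelve. all: by end_near. Qed.

End W.
End Expansion.

(** * Sampling and the two-phase system *)

Section Final.
Context {R : realType}.
Local Notation plane := 'rV[R]_2.

(** A property of all large radii holds at all sampling radii for large [t]. *)
Lemma near_sample n (sigma : 'I_n -> R) (s : R -> 'I_n -> R) (beta : R) (P : R -> Prop) :
  (forall j, 0 < sigma j) ->
  (\forall t \near +oo, forall j, `|s t j - sigma j * t| <= beta) ->
  (\forall x \near +oo, P x) -> \forall t \near +oo, forall j, P (s t j).
Proof.
move=> sp sb [B [_ HB]]; apply: filter_forall => j.
have sj := sp j.
near=> t; apply: HB.
have h : `|s t j - sigma j * t| <= beta by move: (j); near: t.
have t1 : (B + beta) / sigma j < t by near: t; exact/nbhs_pinfty_gt/num_real.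
rewrite ltr_pdivrMr// in t1.
by move: h; rewrite ler_norml => /andP[]; lra.
Unshelve. all: by end_near. Qed.

Lemma sample_inv_le n (sigma : 'I_n -> R) (s : R -> 'I_n -> R) (beta : R) (m : nat) :
  (forall j, 0 < sigma j) ->
  (\forall t \near +oo, forall j, `|s t j - sigma j * t| <= beta) ->
  exists2 Q : R, 0 <= Q & \forall t \near +oo, forall j, (s t j ^+ m)^-1 <= Q / t ^+ m.
Proof.
move=> sp sb.
pose q := \sum_j 2 / sigma j.
have qj j : 2 / sigma j <= q.
  by rewrite /q (bigD1 j)//= lerDl sumr_ge0// => i _; rewrite divr_ge0// ltW.
have q0 : 0 <= q by apply: sumr_ge0 => j _; rewrite divr_ge0// ltW.
exists (q ^+ m); first exact: exprn_ge0.
apply: filter_forall => j; have sj := sp j; near=> t.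
have t0 : 0 < t by near: t; exact/nbhs_pinfty_gt/num_real.
have h : `|s t j - sigma j * t| <= beta by move: (j); near: t.
have t1 : 2 * beta / sigma j < t by near: t; exact/nbhs_pinfty_gt/num_real.
rewrite ltr_pdivrMr// in t1.
have lb : sigma j * t / 2 <= s t j by move: h; rewrite ler_norml => /andP[]; lra.
have p0 : 0 < sigma j * t / 2 by rewrite divr_gt0// mulr_gt0.
have a : (s t j)^-1 <= q / t.
  apply: (@le_trans _ _ (sigma j * t / 2)^-1).
    by rewrite lef_pV2 ?posrE// (lt_le_trans p0).
  rewrite (_ : _^-1 = 2 / sigma j / t); last by field; rewrite !gt_eqF.
  by rewrite ler_pM2r ?invr_gt0.
have a0 : 0 <= (s t j)^-1 by rewrite invr_ge0 (le_trans (ltW p0)).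
rewrite -exprVn -exprVn -exprMn; apply: lerXn2r => //.
by rewrite nnegrE (le_trans a0).
Unshelve. all: by end_near. Qed.

Lemma admissible_bound n (n_gt0 : (0 < n)%N) k d u xhat delta (sigma : 'I_n -> R) tau0
    (b : 'I_n -> R -> R) (t : R) : 0 < k -> 0 < delta ->
  admissible_offsets n_gt0 k d u xhat delta sigma tau0 b t ->
  forall j, `|sample sigma b t j - sigma j * t| <=
    `|tau0| + delta + 2 * pi / (k * `|dot xhat d|).
Proof.
move=> k0 d0 [h1 h2 _] j.
have p0 : 0 <= 2 * pi / (k * `|dot xhat d|).
  by rewrite divr_ge0 ?mulr_ge0 ?pi_ge0// ltW.
rewrite /sample addrC addKr.
have [->|ne] := eqVneq j (Ordinal n_gt0).
  have := ler_norm tau0; have := lerNnormlW (lexx `|tau0|).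
  by rewrite ler_norml; move: h1 p0; set P := _ / _; lra.
have := normr_ge0 tau0.
by rewrite ler_norml; move: (h2 j ne) p0; set P := _ / _; lra.
Qed.

(** The solution of the Vandermonde system approximates the numbers
    [2 Re (e^(- i theta) g_j)]. The phase [theta] depends on [t]. *)
Lemma G_M_expansion n (n_gt0 : (0 < n)%N) (k : R) (d xhat : plane) (u : plane -> R[i])
    (g : nat -> plane -> R[i]) (delta tau0 : R) (sigma : 'I_n -> R) (b : 'I_n -> R -> R) :
  0 < k -> enorm xhat = 1 ->
  (forall e : R, 0 < e -> \forall r \near +oo, normc (u_H k d u (r *: xhat)) ^+ 2 <= e) ->
  atkinson_expansion k (u_M k d u) g ->
  0 < delta -> (forall j, 0 < sigma j) -> injective sigma ->
  (\forall t \near +oo, admissible_offsets n_gt0 k d u xhat delta sigma tau0 b t) ->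
  forall j : 'I_n, exists C : R, \forall t \near +oo,
    `|G_M k d u xhat (sample sigma b t) j ord0 -
      rot_re (k * (sigma (Ordinal n_gt0) * t + tau0) * dot xhat d) (g j.+1 xhat)|
    <= C / t ^+ (n - j).
Proof.
move=> k0 x1 uH0 atk d0 sp si adm j.
have sb : \forall t \near +oo, forall j, `|sample sigma b t j - sigma j * t| <=
    `|tau0| + delta + 2 * pi / (k * `|dot xhat d|).
  by apply: filterS adm => t; exact: admissible_bound.
have [K HK] := Vmx_stable sp si sb.
have [C HC] := w_expansion k0 x1 uH0 atk n_gt0.
have HC' := near_sample sp sb HC.
have HS := near_sample sp sb (nbhs_pinfty_gt (num_real (0 : R))).
have [Q Q0 HQ] := sample_inv_le n sp sb.
exists (K * (`|C| * Q)); near=> t.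
have t0 : 0 < t by near: t; exact/nbhs_pinfty_gt/num_real.
have [_ _ harg] : admissible_offsets n_gt0 k d u xhat delta sigma tau0 b t by near: t.
have [uV stab] : Vmx (sample sigma b t) \in unitmx /\
    forall (G : 'cV[R]_n) (e : R), (forall i, `|(Vmx (sample sigma b t) *m G) i ord0| <= e) ->
      forall j, `|G j ord0| <= K * t ^+ j * e by near: t.
have hw : forall i, forall theta,
  is_arg (incident_plus_uH k d u (sample sigma b t i *: xhat)) theta ->
  `|w k d u (sample sigma b t i *: xhat) -
    \sum_(j < n) rot_re theta (g j.+1 xhat) / sample sigma b t i ^+ j| <=
    C / sample sigma b t i ^+ n by near: t.
have hQ : forall i, (sample sigma b t i ^+ n)^-1 <= Q / t ^+ n by near: t.
have hs : forall i, 0 < sample sigma b t i by near: t.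
set theta := k * _ * _ in harg *.
pose H : 'cV[R]_n := \col_j rot_re theta (g j.+1 xhat).
have BE (A B : 'cV[R]_n) i : (A - B) i ord0 = A i ord0 - B i ord0 by rewrite !mxE.
have -> : G_M k d u xhat (sample sigma b t) j ord0 - rot_re theta (g j.+1 xhat) =
    (G_M k d u xhat (sample sigma b t) - H) j ord0 by rewrite BE [H _ _]mxE.
have tj : t ^+ n = t ^+ (n - j) * t ^+ j by rewrite -exprD subnK// ltnW.
apply: (@le_trans _ _ (K * t ^+ j * (`|C| * (Q / t ^+ n)))).
  apply: stab => i; rewrite mulmxBr /G_M mulKVmx// BE [X in X - _]mxE.
  rewrite [X in _ - X](_ : _ = \sum_(j < n) rot_re theta (g j.+1 xhat) / sample sigma b t i ^+ j).
    apply: (le_trans (hw i theta (harg i))).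
    have sV0 : 0 <= (sample sigma b t i ^+ n)^-1 by rewrite invr_ge0 exprn_ge0// ltW.
    apply: (@le_trans _ _ (`|C| / sample sigma b t i ^+ n)).
      by rewrite ler_wpM2r// ler_norm.
    by rewrite ler_wpM2l.
  by rewrite mxE; apply: eq_bigr => l _; rewrite !mxE mulrC.
rewrite tj le_eqVlt; apply/orP; left; apply/eqP; field.
by rewrite !expf_neq0// gt_eqF.
Unshelve. all: by end_near. Qed.

Lemma sin_eq0_int (x : R) : sin x = 0 -> exists l : int, x = l%:~R * pi.
Proof.
move=> sx; pose l := Num.floor (x / pi); exists l.
have sinn (n : nat) : sin (n%:R * pi) = 0 :> R.
  elim: n => [|n IH]; first by rewrite mul0r sin0.
  by rewrite -natr1 mulrDl mul1r sinDpi IH oppr0.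
have sinl : sin (l%:~R * pi) = 0 :> R.
  case: (l) => n; first exact: sinn.
  by rewrite NegzE rmorphN mulNr sinN -[X in - sin X]/(n.+1%:R * pi) sinn oppr0.
have sy : sin (x - l%:~R * pi) = 0 by rewrite sinB sx sinl mul0r mulr0 subr0.
have /andP[] := Num.Theory.floor_itv (x / pi); rewrite -/l => l1 l2.
rewrite ler_pdivlMr ?pi_gt0// in l1.
rewrite ltr_pdivrMr ?pi_gt0// rmorphD/= mulrDl mul1r in l2.
apply/eqP; rewrite -subr_eq0; apply/eqP/le_anti/andP; split; last by rewrite subr_ge0.
rewrite leNgt; apply/negP => y0.
have : 0 < sin (x - l%:~R * pi) by apply: sin_gt0_pi; rewrite y0/= ltrBlDl.
by rewrite sy ltxx.
Qed.

Lemma cisD (a b : R) : cis (a + b) = cis a * cis b.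
Proof. by rewrite /cis cosD sinD; simpc; congr (_ +i* _); ring. Qed.

Lemma phase_mulE (t0 t1 : R) (z : 'cV[R[i]]_2) :
  phase_mx t0 t1 *m z = col2 (cis (- t0) * z ord0 ord0 + cis t0 * z (lift ord0 ord0) ord0)
    (cis (- t1) * z ord0 ord0 + cis t1 * z (lift ord0 ord0) ord0).
Proof.
apply/colP => i; rewrite !mxE !big_ord_recl big_ord0 addr0 !mxE/=.
by case: (unliftP ord0 i) => [l ->|->]; rewrite ?ord1.
Qed.

(** Cramer's rule; the determinant is [2 i sin (t1 - t0)]. *)
Lemma phase_bound (t0 t1 : R) (z : 'cV[R[i]]_2) (x y : R[i]) : sin (t1 - t0) != 0 ->
  phase_mx t0 t1 *m z = col2 x y ->
  forall i, normc (z i ord0) <= (normc x + normc y) / `|sin (t1 - t0)|.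
Proof.
move=> s0; rewrite phase_mulE => /colP E i.
have := E ord0; have := E (lift ord0 ord0); rewrite !mxE/=.
set a := z ord0 ord0; set b := z (lift ord0 ord0) ord0 => Ey Ex.
have D : cis (t1 - t0) - cis (t0 - t1) = (0 +i* (2 * sin (t1 - t0))) :> R[i].
  rewrite -[t0 - t1]opprB; move: (t1 - t0) => y'.
  by rewrite /cis cosN sinN; simpc; congr (_ +i* _); ring.
have nD : normc (0 +i* (2 * sin (t1 - t0)) : R[i]) = 2 * `|sin (t1 - t0)|.
  by rewrite /= expr0n/= add0r sqrtr_sqr normrM ger0_norm.
have Ea : a * (0 +i* (2 * sin (t1 - t0))) = x * cis t1 - y * cis t0.
  rewrite -Ex -Ey -D [t1 - t0]addrC [t0 - t1]addrC !cisD.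
  by move: (cis _) (cis _) (cis _) (cis _) => c1 c2 c3 c4; ring.
have Eb : b * (0 +i* (2 * sin (t1 - t0))) = y * cis (- t0) - x * cis (- t1).
  rewrite -Ex -Ey -D [t1 - t0]addrC [t0 - t1]addrC !cisD.
  by move: (cis _) (cis _) (cis _) (cis _) => c1 c2 c3 c4; ring.
have sp : 0 < `|sin (t1 - t0)| by rewrite normr_gt0.
have fin (c p q : R[i]) (s t : R) : c * (0 +i* (2 * sin (t1 - t0))) = p * cis s - q * cis t ->
    normc c <= (normc p + normc q) / `|sin (t1 - t0)|.
  move=> /(congr1 (@normc R)); rewrite normcM nD => e.
  have : normc c * (2 * `|sin (t1 - t0)|) <= normc p + normc q.
    rewrite e; apply: (le_trans (le_normcD _ _)).
    by rewrite normcN !normcM !normc_cis !mulr1.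
  rewrite ler_pdivlMr// => h; have : 0 <= normc c * `|sin (t1 - t0)|.
    by rewrite mulr_ge0 ?normc_ge0.
  by move: h; rewrite mulrCA; lra.
case: (unliftP ord0 i) => [l ->|->]; rewrite ?ord1.
  by rewrite [normc x + _]addrC; exact: fin Eb.
exact: fin Ea.
Qed.

End Final.

(** * Recovery of the expansion coefficients *)

Lemma phase_mx_unit (R : realType) (t0 t1 : R) : sin (t1 - t0) != 0 -> phase_mx t0 t1 \in unitmx.
Proof.
move=> s0; apply: unitmx_of_ker => z Pz; apply/colP => i; rewrite [RHS]mxE.
apply: (@eq0_normc R).
have E : phase_mx t0 t1 *m z = col2 0 0.
  by rewrite Pz; apply/colP => l; rewrite !mxE; case: ifP.
apply/eqP; rewrite eq_le normc_ge0 andbT.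
by have := phase_bound s0 E i; rewrite (@normc0 R) addr0 mul0r.
Qed.

(** Error in the recovered pair [(z, conj z)] when the two numbers [rot_re] are
    replaced by [x] and [y]. *)
Lemma phase_solve (R : realType) (t0 t1 x y : R) (z : R[i]) (i : 'I_2) :
  sin (t1 - t0) != 0 ->
  normc ((col2 z z^* - invmx (phase_mx t0 t1) *m col2 x%:C y%:C) i ord0) <=
    (`|x - rot_re t0 z| + `|y - rot_re t1 z|) / `|sin (t1 - t0)|.
Proof.
move=> s0; have uP := phase_mx_unit s0.
have E : phase_mx t0 t1 *m (col2 z z^* - invmx (phase_mx t0 t1) *m col2 x%:C y%:C) =
    col2 (rot_re t0 z - x)%:C (rot_re t1 z - y)%:C.
  rewrite mulmxBr mulKVmx// phase_mulE.
  have ph th : cis (- th) * z + cis th * z^* = (rot_re th z)%:C.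
    rewrite /rot_re /cis cosN sinN; case: z => p q; simpc.
    by apply/eqP; rewrite eq_complex /=; apply/andP; split; apply/eqP; ring.
  by apply/colP => l; rewrite !mxE/= !ph; case: ifP => _; rewrite -rmorphB.
apply: (le_trans (phase_bound s0 E i)).
by rewrite !normc_real distrC [X in _ + X]distrC.
Qed.

Theorem theorem4p12 (R : realType) (k alpha : R) (D : set 'rV[R]_2)
  (nu : 'rV[R]_2 -> 'rV[R]_2) (B : boundary_operator) (d : 'rV[R]_2)
  (u : 'rV[R]_2 -> R[i]) (g : nat -> 'rV[R]_2 -> R[i])
  (n : nat) (n_gt0 : (0 < n)%N) (delta tau : R) (sigma : 'I_n -> R)
  (xhat : 'rV[R]_2) (b bt : 'I_n -> R -> R) :
  0 < k -> 0 < alpha <= 1 -> obstacle alpha D ->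
  (forall p, boundary D p -> exterior_normal D p (nu p)) ->
  enorm d = 1 ->
  scattering_solution B k D nu d u ->
  atkinson_expansion k (u_M k d u) g ->
  0 < delta -> (forall j, 0 < sigma j) ->
  injective sigma -> (forall j, sigma j != delta) ->
  enorm xhat = 1 -> dot xhat d != 0 ->
  (forall l : int, tau != l%:~R * pi / (k * dot xhat d)) ->
  (\forall t \near +oo, admissible_offsets n_gt0 k d u xhat delta sigma 0 b t) ->
  (\forall t \near +oo, admissible_offsets n_gt0 k d u xhat delta sigma tau bt t) ->
  let sigma1 := sigma (Ordinal n_gt0) in
  let c := dot xhat d in
  forall j : 'I_n, exists C : R, \forall t \near +oo, forall i : 'I_2,
    normc ((col2 (g j.+1 xhat) (g j.+1 xhat)^* -
            invmx (phase_mx (k * sigma1 * t * c) (k * (sigma1 * t + tau) * c)) *m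
            col2 (G_M k d u xhat (sample sigma b t) j ord0)%:C
                 (G_M k d u xhat (sample sigma bt t) j ord0)%:C) i ord0)
    <= C / t ^+ (n - j).
Proof.
move=> k0 _ [[_ _ _ bD] _] _ d1 [cu bih _ rad] atk d0 sp si _ x1 c0 tauP adm admt.
move=> sigma1 c j.
have [C0] := atk 0; rewrite /= => hC0.
(* at order 0 the expansion bounds u_M *)
have uH0 : forall e : R, 0 < e -> \forall r \near +oo,
    normc (u_H k d u (r *: xhat)) ^+ 2 <= e.
  apply: (uH_decay (C := C0) k0 bD d1 x1 cu bih rad).
  apply: filterS hC0 => r h y y1; have := h y y1.
  by rewrite big_geq// mulr0 subr0 expr0 divr1.
have [C HC] := G_M_expansion k0 x1 uH0 atk d0 sp si adm j.
have [Ct HCt] := G_M_expansion k0 x1 uH0 atk d0 sp si admt j.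
have kc : k * c != 0 by rewrite mulf_neq0// gt_eqF.
pose S := sin (k * tau * c).
have S0 : S != 0.
  apply/eqP => /sin_eq0_int[l lE]; have /eqP := tauP l; apply.
  by rewrite -lE -/c (_ : k * tau * c = tau * (k * c)) ?mulfK//; ring.
exists ((C + Ct) / `|S|); near=> t.
have hC : `|G_M k d u xhat (sample sigma b t) j ord0 -
      rot_re (k * (sigma1 * t + 0) * c) (g j.+1 xhat)| <= C / t ^+ (n - j) by near: t.
have hCt : `|G_M k d u xhat (sample sigma bt t) j ord0 -
      rot_re (k * (sigma1 * t + tau) * c) (g j.+1 xhat)| <= Ct / t ^+ (n - j) by near: t.
rewrite addr0 in hC.
rewrite (mulrA k sigma1 t) in hC.
have dt : k * (sigma1 * t + tau) * c - k * sigma1 * t * c = k * tau * c by ring.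
have s0 : sin (k * (sigma1 * t + tau) * c - k * sigma1 * t * c) != 0 by rewrite dt.
move=> i; apply: (le_trans (phase_solve _ _ _ i s0)).
have -> : (C + Ct) / `|S| / t ^+ (n - j) = (C / t ^+ (n - j) + Ct / t ^+ (n - j)) / `|S|.
  by rewrite mulrAC mulrDl.
rewrite dt -/S; apply: ler_wpM2r; first by rewrite invr_ge0.
exact: lerD.
Unshelve. all: by end_near. Qed.
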